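(* Consider the system $$\dot x=f(x,t,p(t/\alpha)),\qquad x\in\mathbb{R}^n, \tag{S}$$ where $f:\mathbb{R}^n\times[0,\infty)\times\mathbb{R}^d\to\mathbb{R}^n$, $\alpha>0$ is a constant, and $p:\mathbb{R}\to\mathbb{R}^d$ is bounded and its components $p_1,\ldots,p_d$ have bounded first derivatives. Put $\mathcal{R}(p):=\{p(t):t\in\mathbb{R}\}$. Suppose there exist $\tilde\alpha_1,\tilde\alpha_2\in\mathcal{K}_\infty$, a positive definite $C^1$ function $\mu:[0,\infty)\to[0,\infty)$, positive constants $T,\tilde c_a,\tilde c_b$, a continuous function $\tilde q:\mathbb{R}^d\to\mathbb{R}$, and a $C^1$ function $\tilde V:\mathbb{R}^n\times[0,\infty)\times\mathbb{R}^d\to[0,\infty)$ such that $$\lim_{r\to+\infty}\int_1^r\frac{1}{\mu(l)}\,dl=+\infty$$ and, for all $x\in\mathbb{R}^n$, $t\ge0$ and $\tau\in\mathcal{R}(p)$: - $\tilde\alpha_1(|x|)\le\tilde V(x,t,\tau)\le\tilde\alpha_2(|x|)$; - $\tilde V_t(x,t,\tau)+\tilde V_x(x,t,\tau)f(x,t,\tau)\le-\tilde q(\tau)\,\mu(\tilde V(x,t,\tau))$; - $|\tilde V_\tau(x,t,\tau)|\le\tilde c_a\,\mu(\tilde V(x,t,\tau))$; - $\int_{t-T}^t\tilde q(p(s))\,ds\ge\tilde c_b$. Then there exists $k\in\mathcal{K}_\infty$ such that $V:=k(\tilde V)$ satisfies Condition (E) stated in the context. Therefore, for each sufficiently large value of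 the constant $\alpha>0$, the system (S) is UGAS and admits a Lyapunov function of the form $$V^\sharp_\alpha(x,t)=\exp\left(\frac{\alpha}{T}\int_{\frac t\alpha-T}^{\frac t\alpha}\int_s^{\frac t\alpha}q(p(l))\,dl\,ds\right)V(x,t,p(t/\alpha)),$$ with $V=k(\tilde V)$ and with $q$, $T$ as in Condition (E).
   Context: Condition (E) for a function $V$: $V:\mathbb{R}^n\times[0,\infty)\times\mathbb{R}^d\to[0,\infty)$ is $C^1$ and there exist $\alpha_1,\alpha_2\in\mathcal{K}_\infty$, positive constants $c_a,c_b,T$, and a continuous function $q:\mathbb{R}^d\to\mathbb{R}$ such that for all $x\in\mathbb{R}^n$, $t\ge0$, $\tau\in\mathcal{R}(p)$: (1) $\alpha_1(|x|)\le V(x,t,\tau)\le\alpha_2(|x|)$; (2) $V_t(x,t,\tau)+V_x(x,t,\tau)f(x,t,\tau)\le-q(\tau)V(x,t,\tau)$; (3) $|V_\tau(x,t,\tau)|\le c_aV(x,t,\tau)$; (4) $\int_{t-T}^tq(p(s))\,ds\ge c_b$. $|\cdot|$ is the Euclidean norm; subscripts on functions denote partial gradients. $C^1$ means continuously differentiable (one-sided at the endpoint $0$ of $[0,\infty)$). $\mathcal{K}_\infty$: continuous, strictly increasing, unbounded functions $\rho:[0,\infty)\to[0,\infty)$ with $\rho(0)=0$. $\mathcal{KL}$: continuous functions $\beta:[0,\infty)\times[0,\infty)\to[0,\infty)$ such that $\beta(\cdot,t)\in\mathcal{K}_\infty$ for each $t\ge0$, $\beta(s,\cdot)$ is non-increasing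 for each $s\ge0$, and $\beta(s,t)\to0$ as $t\to+\infty$ for each $s\ge 0$. A continuous function $\rho:[0,\infty)\to[0,\infty)$ is positive definite if it is zero only at zero. For a system $\dot x=h(x,t)$ on $\mathbb{R}^n$, $t\ge 0$: - It is forward complete if for each $x_o\in\mathbb{R}^n$, $t_o\ge0$ there is a unique trajectory $t\mapsto\phi(t;t_o,x_o)$ defined on $[t_o,\infty)$ with value $x_o$ at $t_o$. - It is UGAS (uniformly globally asymptotically stable) if there is $\beta\in\mathcal{KL}$ with $|\phi(t;t_o,x_o)|\le\beta(|x_o|,t-t_o)$ for all $x_o\in\mathbb{R}^n$, $t_o\ge0$, $t\ge t_o$. - A Lyapunov function for it is a $C^1$ function $W:\mathbb{R}^n\times[0,\infty)\to[0,\infty)$ for which there are $\alpha_1,\alpha_2\in\mathcal{K}_\infty$ and a positive definite $\alpha_3$ such that $\alpha_1(|x|)\le W(x,t)\le\alpha_2(|x|)$ and $W_t(x,t)+W_x(x,t)h(x,t)\le-\alpha_3(|x|)$ for all $t\ge0$, $x\in\mathbb{R}^n$. Standing assumptions: for $h(x,t)=f(x,t,p(t/\alpha))$ (every $\alpha>0$) and $h(x,t)=f(x,t,\tau)$ (every $\tau\in\mathcal{R}(p)$), $h$ is locally Lipschitz, $\dot x=h(x,t)$ is forward complete, and there is $\alpha_h\in\mathcal{K}_\infty$ with $|h(x,t)|\le\alpha_h(|x|)$ for all $x,t$.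
   Formalization: The claim that V^sharp_alpha is a Lyapunov function (hence C^1) is made only when the derivatives of p_1,…,p_d are continuous, since it fails for bounded discontinuous derivatives; Condition (E) for k(V~) and UGAS need no such assumption. *)

(* Defs.v *)
From HB Require Import structures.
From mathcomp Require Import all_boot all_order all_algebra.
From mathcomp Require Import all_classical all_reals all_analysis.
Set Implicit Arguments.
Unset Strict Implicit.
Unset Printing Implicit Defensive.
Import Order.TTheory GRing.Theory Num.Theory.
Import numFieldNormedType.Exports.
Local Open Scope ring_scope.
Local Open Scope classical_set_scope.

(* R^n is 'rV[R]_n. The library norm on 'rV[R]_n is the sup norm, which is used
   only for the topology and for local Lipschitz continuity, where the choice of
   norm is immaterial; |.| is the Euclidean norm enorm.
   A function on [0, +oo[ is a total function on R, of which only the values at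
   nonnegative arguments are ever constrained or used. *)

Definition enorm (R : realType) (n : nat) (v : 'rV[R]_n) : R :=
  Num.sqrt (\sum_i v 0 i ^+ 2).

Definition dot (R : realType) (n : nat) (u v : 'rV[R]_n) : R :=
  \sum_i u 0 i * v 0 i.

Definition class_Kinf (R : realType) (rho : R -> R) : Prop :=
  [/\ {within `[0, +oo[, continuous rho},
      forall r s, 0 <= r -> r < s -> rho r < rho s,
      forall M, exists2 r, 0 <= r & M < rho r
    & rho 0 = 0].

Definition class_KL (R : realType) (beta : R -> R -> R) : Prop :=
  [/\ {within `[0, +oo[ `*` `[0, +oo[,
        continuous (fun z : R * R => beta z.1 z.2)},
      forall t, 0 <= t -> class_Kinf (beta ^~ t),
      forall s t t', 0 <= s -> 0 <= t -> t <= t' -> beta s t' <= beta s t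
    & forall s, 0 <= s -> beta s t @[t --> +oo] --> 0].

Definition positive_definite (R : realType) (rho : R -> R) : Prop :=
  [/\ {within `[0, +oo[, continuous rho},
      forall r, 0 <= r -> 0 <= rho r
    & forall r, 0 <= r -> (rho r = 0 <-> r = 0)].

(* Difference quotient of g at t along [a, +oo[: its limit is the usual
   derivative for a < t and the right derivative for t = a. *)
Definition dquot (R : realType) (V : normedModType R) (a : R) (g : R -> V)
    (t : R) : set_system V :=
  (s - t)^-1 *: (g s - g t) @[s --> within `[a, +oo[ t^'].

Definition derivable_from (R : realType) (a : R) (g : R -> R) (t : R) : Prop :=
  cvg (dquot a g t).

Definition derive_from (R : realType) (a : R) (g : R -> R) (t : R) : R :=
  lim (dquot a g t).

Definition C1_halfline (R : realType) (g : R -> R) : Prop :=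
  (forall t, 0 <= t -> derivable_from 0 g t) /\
  {within `[0, +oo[, continuous (derive_from 0 g)}.

Definition has_grad (R : realType) (n : nat) (g : 'rV[R]_n -> R)
    (x : 'rV[R]_n) : Prop :=
  forall i, derivable g x (delta_mx 0 i).

Definition grad (R : realType) (n : nat) (g : 'rV[R]_n -> R)
    (x : 'rV[R]_n) : 'rV[R]_n :=
  \row_i 'D_(delta_mx 0 i) g x.

Section functions_of_state_and_time.
Variables (R : realType) (n : nat) (W : 'rV[R]_n -> R -> R).

Definition W_x (x : 'rV[R]_n) (t : R) : 'rV[R]_n := grad (W ^~ t) x.
Definition W_t (x : 'rV[R]_n) (t : R) : R := derive_from 0 (W x) t.

Definition C1_xt : Prop :=
  [/\ forall x t, 0 <= t ->
        has_grad (W ^~ t) x /\ derivable_from 0 (W x) t,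
      {within [set z : 'rV[R]_n * R | 0 <= z.2],
        continuous (fun z => W_x z.1 z.2)}
    & {within [set z : 'rV[R]_n * R | 0 <= z.2],
        continuous (fun z => W_t z.1 z.2)}].

End functions_of_state_and_time.

Section functions_of_state_time_and_parameter.
Variables (R : realType) (n d : nat) (V : 'rV[R]_n -> R -> 'rV[R]_d -> R).

Definition V_x (x : 'rV[R]_n) (t : R) (tau : 'rV[R]_d) : 'rV[R]_n :=
  grad (fun y => V y t tau) x.
Definition V_t (x : 'rV[R]_n) (t : R) (tau : 'rV[R]_d) : R :=
  derive_from 0 (fun s => V x s tau) t.
Definition V_tau (x : 'rV[R]_n) (t : R) (tau : 'rV[R]_d) : 'rV[R]_d :=
  grad (V x t) tau.

Let dom : set ('rV[R]_n * R * 'rV[R]_d) := [set z | 0 <= z.1.2].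

Definition C1_xttau : Prop :=
  [/\ forall x t tau, 0 <= t ->
        [/\ has_grad (fun y => V y t tau) x,
            derivable_from 0 (fun s => V x s tau) t
          & has_grad (V x t) tau],
      {within dom, continuous (fun z => V_x z.1.1 z.1.2 z.2)},
      {within dom, continuous (fun z => V_t z.1.1 z.1.2 z.2)}
    & {within dom, continuous (fun z => V_tau z.1.1 z.1.2 z.2)}].

End functions_of_state_time_and_parameter.

Section systems.
Variables (R : realType) (n : nat) (h : 'rV[R]_n -> R -> 'rV[R]_n).

Definition locally_lipschitz : Prop :=
  forall z0 : 'rV[R]_n * R, 0 <= z0.2 ->
    exists2 r : R, 0 < r &
      [lipschitz h z.1 z.2 | z in ball z0 r `&` [set z | 0 <= z.2]].

Definition is_trajectory (t0 : R) (x0 : 'rV[R]_n) (phi : R -> 'rV[R]_n) : Prop :=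
  phi t0 = x0 /\ forall t, t0 <= t -> dquot t0 phi t --> h (phi t) t.

Definition forward_complete : Prop :=
  forall x0 t0, 0 <= t0 ->
    (exists phi, is_trajectory t0 x0 phi) /\
    (forall phi psi, is_trajectory t0 x0 phi -> is_trajectory t0 x0 psi ->
       forall t, t0 <= t -> phi t = psi t).

Definition standing_conditions : Prop :=
  [/\ locally_lipschitz,
      forward_complete
    & exists2 alpha_h : R -> R, class_Kinf alpha_h &
        forall x t, 0 <= t -> enorm (h x t) <= alpha_h (enorm x)].

(* Meant for forward complete systems, where phi ranges over the unique
   trajectory through (t0, x0). *)
Definition UGAS : Prop :=
  exists2 beta : R -> R -> R, class_KL beta &
    forall x0 t0 phi, 0 <= t0 -> is_trajectory t0 x0 phi ->
      forall t, t0 <= t -> enorm (phi t) <= beta (enorm x0) (t - t0).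

Definition lyapunov_function (W : 'rV[R]_n -> R -> R) : Prop :=
  [/\ C1_xt W,
      forall x t, 0 <= t -> 0 <= W x t
    & exists alpha1 alpha2 alpha3 : R -> R,
        [/\ class_Kinf alpha1, class_Kinf alpha2, positive_definite alpha3
          & forall x t, 0 <= t ->
              [/\ alpha1 (enorm x) <= W x t, W x t <= alpha2 (enorm x)
                & W_t W x t + dot (W_x W x t) (h x t) <= - alpha3 (enorm x)]]].

End systems.

Section parametrized_systems.
Variables (R : realType) (n d : nat).
Variables (f : 'rV[R]_n -> R -> 'rV[R]_d -> 'rV[R]_n) (p : R -> 'rV[R]_d).

Definition slow_system (alpha : R) (x : 'rV[R]_n) (t : R) : 'rV[R]_n :=
  f x t (p (t / alpha)).

Definition frozen_system (tau : 'rV[R]_d) (x : 'rV[R]_n) (t : R) : 'rV[R]_n :=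
  f x t tau.

Definition standing_assumptions : Prop :=
  (forall alpha, 0 < alpha -> standing_conditions (slow_system alpha)) /\
  (forall tau, range p tau -> standing_conditions (frozen_system tau)).

(* q and T are exposed because they enter the formula for V_sharp. *)
Definition condition_E_with (V : 'rV[R]_n -> R -> 'rV[R]_d -> R)
    (q : 'rV[R]_d -> R) (T : R) : Prop :=
  [/\ C1_xttau V /\ (forall x t tau, 0 <= t -> 0 <= V x t tau),
      continuous q,
      0 < T
    & exists (alpha1 alpha2 : R -> R) (ca cb : R),
        [/\ class_Kinf alpha1, class_Kinf alpha2, 0 < ca, 0 < cb
          & forall x t tau, 0 <= t -> range p tau ->
              [/\ alpha1 (enorm x) <= V x t tau <= alpha2 (enorm x),
                  V_t V x t tau + dot (V_x V x t tau) (f x t tau)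
                    <= - q tau * V x t tau,
                  enorm (V_tau V x t tau) <= ca * V x t tau
                & cb <= \int[lebesgue_measure]_(s in `[t - T, t]) q (p s)]]].

Definition condition_E (V : 'rV[R]_n -> R -> 'rV[R]_d -> R) : Prop :=
  exists q T, condition_E_with V q T.

Definition V_sharp (V : 'rV[R]_n -> R -> 'rV[R]_d -> R) (q : 'rV[R]_d -> R)
    (T alpha : R) (x : 'rV[R]_n) (t : R) : R :=
  expR (alpha / T *
    \int[lebesgue_measure]_(s in `[t / alpha - T, t / alpha])
      \int[lebesgue_measure]_(l in `[s, t / alpha]) q (p l))
  * V x t (p (t / alpha)).

End parametrized_systems.

Section slow_parameter.
Variables (R : realType) (d : nat) (p : R -> 'rV[R]_d).

Definition bounded_curve : Prop := exists M : R, forall t, enorm (p t) <= M.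

Definition bounded_derivatives : Prop :=
  forall i, (forall t, derivable (fun s => p s 0 i) t 1) /\
    exists M : R, forall t, `|(fun s => p s 0 i)^`() t| <= M.

(* Not implied by bounded_derivatives. It is what makes t |-> V x t (p t) of
   class C^1, rather than merely differentiable, for V of class C^1. *)
Definition continuous_derivatives : Prop :=
  forall i, continuous (fun s => p s 0 i)^`().

End slow_parameter.

(* Main.v *)
(* Let L be a primitive of 1/mu on ]0, +oo[ and k(v) = exp(c L(v)), k(0) = 0.
   Then mu k' = c k turns the hypotheses on V, which involve mu(V), into linear
   ones on k(V), with q replaced by c q.
   For the stability part, the logarithmic derivative of the exponential weight
   in V_sharp is q(p(t/alpha)) minus the mean of q(p(.)) over a window of length
   T. The first term cancels the decay rate of V, the mean is at least cb/T, and
   the drift of the parameter contributes only O(1/alpha), so V_sharp decays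
   exponentially along trajectories when alpha is large. *)
Require Import Defs.
From HB Require Import structures.
From mathcomp Require Import all_boot all_order all_algebra.
From mathcomp Require Import all_classical all_reals all_analysis.
From mathcomp Require Import ring lra.
Set Implicit Arguments.
Unset Strict Implicit.
Unset Printing Implicit Defensive.
Import Order.TTheory GRing.Theory Num.Theory.
Import numFieldNormedType.Exports.
Local Open Scope ring_scope.
Local Open Scope classical_set_scope.

(** The factor [c] in the rescaling is free, since it only multiplies the rate, [ca] and [cb]; it is
    spent on the smoothness of [k] at 0. The origin is the delicate point: [mu] vanishes there at
    least linearly, so 1/mu is not integrable near 0 and L tends to -oo, which makes k(0) = 0 the
    continuous extension. At the other end, the divergence of the integral makes [k] unbounded.
    Being C^1 here means having continuous partial derivatives, one-sided in time at 0, and a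
    trajectory has only a right derivative at its initial time. Hence the differentiation rules
    concern difference quotients along a filter, and the chain rule for V rests on strict
    differentiability, deduced from the partial derivatives by the mean value theorem. In the UGAS
    part the derivative of [p] may be discontinuous, so the decay along trajectories is drawn from
    the pointwise sign of a derivative instead of integrating it. The weight is bounded only by
    constants that depend on alpha, which is harmless: the decay rate does not depend on alpha. *)

(** * One-sided and two-sided difference quotients *)

Section difference_quotients.
Context {R : realType}.
Implicit Types (g : R -> R) (a t l : R).

(** The substitution s = t + h turns the usual derivative into a limit of the quotients used in
    [dquot], so that both kinds of derivative obey the same rules. *)
Lemma is_derive_quotP g t l :
  is_derive t 1 g l <-> (s - t)^-1 *: (g s - g t) @[s --> t^'] --> l.
Proof.
have E : (s - t)^-1 *: (g s - g t) @[s --> t^'] =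
         h^-1 *: ((g \o shift t) (h *: 1) - g t) @[h --> 0^'].
  rewrite (_ : t^' = h + t @[h --> 0^']); last first.
    rewrite eqEsubset; split=> A /=.
      move=> [e /= e0 eA]; exists e => // h /= he h0; apply: eA.
        by move: he; rewrite /= sub0r opprD addrCA subrr addr0.
      by rewrite -subr_eq0 addrK.
    move=> [e /= e0 eA]; exists e => // s /= se st.
    have := eA (s - t); rewrite /= sub0r normrN distrC se subr_eq0 subrK.
    by apply.
  rewrite -fmap_comp; apply: (congr1 (fun f => fmap f _)); apply/funext => h.
  by rewrite /= [h *: _]mulr1 addrK.
split=> [[dg dgl]|].
  by rewrite E -dgl; exact: dg.
rewrite E => H; split; last exact: cvg_lim.
by apply/cvg_ex; exists l.
Qed.

Lemma dquot_is_derive a t l g : a < t -> dquot a g t --> l -> is_derive t 1 g l.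
Proof.
move=> lt_at gl; apply/is_derive_quotP; apply: cvg_trans gl; apply: cvg_app.
move=> A; rewrite /within /= => tA.
have ta : t^' `[a, +oo[.
  apply: nbhs_dnbhs; near=> s; rewrite /= in_itv /= andbT; apply: ltW.
  by near: s; exact: lt_nbhsr.
by apply: (@filterS2 _ t^' _ _ _ A _ ta tA) => s sa; apply.
Unshelve. all: by end_near. Qed.

Section along_a_filter.
Context (F : set_system R) {FF : ProperFilter F} (t : R) (Ft : F --> t).

(** Leaving the filter [F] arbitrary lets this and the next two rules serve at interior times, where
    [F] is a punctured neighbourhood, and at an initial time, where it is one-sided. *)
Lemma quot_cvg_continuous (V : normedModType R) (g : R -> V) (l : V) :
  (s - t)^-1 *: (g s - g t) @[s --> F] --> l -> g s @[s --> F] --> g t.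
Proof.
move=> gl.
have E : (fun s => (s - t) *: ((s - t)^-1 *: (g s - g t)) + g t) = g.
  apply/funext => s; have [->|st] := eqVneq s t; first by rewrite !subrr !scaler0 add0r.
  by rewrite scalerA divff ?subr_eq0// scale1r subrK.
rewrite -[X in fmap X]E -[X in _ --> X]add0r.
apply: cvgD; last exact: cvg_cst.
rewrite -(scale0r l) -(subrr t); apply: cvgZ => //.
by apply: cvgB => //; exact: cvg_cst.
Qed.

Lemma quot_cvg_comp g (k : R -> R) l (k' : R) : is_derive (g t) 1 k k' ->
  (s - t)^-1 *: (g s - g t) @[s --> F] --> l ->
  (s - t)^-1 *: (k (g s) - k (g t)) @[s --> F] --> k' * l.
Proof.
move=> /is_derive_quotP kk' gl.
(* The quotient of [k], extended continuously by [k'] at [g t], gives a factorization that remains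
   valid when [g s = g t]. *)
pose psi y := if y == g t then k' else (y - g t)^-1 *: (k y - k (g t)).
have cpsi : psi y @[y --> g t] --> k'.
  have -> : k' = psi (g t) by rewrite /psi eqxx.
  apply/continuous_withinNx; rewrite /psi eqxx.
  apply: cvg_trans kk'; apply: near_eq_cvg; near=> y.
  rewrite ifF//; apply/negbTE.
  by near: y; exact: nbhs_dnbhs_neq.
have E : (fun s => psi (g s) * ((s - t)^-1 *: (g s - g t))) =
  (fun s => (s - t)^-1 *: (k (g s) - k (g t))).
  apply/funext => s; rewrite /psi; case: eqP => [->|/eqP gst].
    by rewrite !subrr !scaler0 mulr0.
  rewrite /GRing.scale /=; set D := (s - t)^-1.
  by field; rewrite subr_eq0.
rewrite -E; apply: cvgM => //.
apply: (cvg_comp g psi) cpsi; exact: quot_cvg_continuous gl.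
Unshelve. all: by end_near. Qed.

Lemma quot_cvgM g1 g2 l1 l2 :
  (s - t)^-1 *: (g1 s - g1 t) @[s --> F] --> l1 ->
  (s - t)^-1 *: (g2 s - g2 t) @[s --> F] --> l2 ->
  (s - t)^-1 *: (g1 s * g2 s - g1 t * g2 t) @[s --> F] -->
    l1 * g2 t + g1 t * l2.
Proof.
move=> gl1 gl2.
have E : (fun s => ((s - t)^-1 *: (g1 s - g1 t)) * g2 s
                   + g1 t * ((s - t)^-1 *: (g2 s - g2 t))) =
         (fun s => (s - t)^-1 *: (g1 s * g2 s - g1 t * g2 t)).
  by apply/funext => s; rewrite /GRing.scale /=; ring.
rewrite -E; apply: cvgD; apply: cvgM => //; first exact: quot_cvg_continuous gl2.
exact: cvg_cst.
Qed.

End along_a_filter.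

Lemma dquot_filter a t : a <= t -> ProperFilter (within `[a, +oo[ (t^')).
Proof.
move=> at_; apply: Build_ProperFilter => //= [[e /= e0 eA]].
have e2 : 0 < e / 2 by rewrite divr_gt0.
apply: (eA (t + e / 2)).
- by rewrite /= opprD addNKr normrN gtr0_norm// ltr_pdivrMr// mulr2n mulrDr mulr1 ltrDl.
- by rewrite -subr_eq0 addrC addKr gt_eqF.
- by rewrite /= in_itv /= andbT (le_trans at_)// lerDl ltW.
Qed.

Lemma dquot_cvg_id a t : within `[a, +oo[ (t^') --> t.
Proof. by apply: cvg_trans (@nbhs_dnbhs _ t); exact: cvg_within. Qed.

Lemma dquot_continuous (V : normedModType R) (g : R -> V) a t (l : V) :
  a <= t -> dquot a g t --> l -> g s @[s --> within `[a, +oo[ (nbhs t)] --> g t.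
Proof.
move=> /dquot_filter FF gl.
have := @quot_cvg_continuous _ FF t (@dquot_cvg_id a t) _ _ _ gl.
move=> cg B Bgt; apply: (@filterS _ (nbhs t) _ _ _ _ (cg B Bgt)) => s gs sa.
by have [->|st] := eqVneq s t; [exact: (nbhs_singleton Bgt)|exact: gs].
Qed.

Lemma derive_fromE a t l g : a <= t -> dquot a g t --> l ->
  derivable_from a g t /\ derive_from a g t = l.
Proof.
move=> /dquot_filter H gl; split; first by apply/cvg_ex; exists l.
by apply: cvg_lim gl.
Qed.

End difference_quotients.

(** * Comparison functions: composition, inverse, exponential KL bounds *)

Section class_K_infinity.
Context {R : realType}.
Implicit Types (rho sigma : R -> R).

Lemma cvg_to_within (T U : Type) (F : set_system T) {FF : Filter F}
    (G : set_system U) (D : set U) (f : T -> U) :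
  f @ F --> G -> (\forall x \near F, D (f x)) -> f @ F --> within D G.
Proof.
by move=> fG fD A GA; apply: filterS2 fD (fG _ GA) => x Dx; apply.
Qed.

Lemma Kinf_ge0 rho r : class_Kinf rho -> 0 <= r -> 0 <= rho r.
Proof.
case=> _ inc _ rho0; rewrite le_eqVlt => /predU1P[<-|r0]; first by rewrite rho0.
by rewrite -rho0 ltW// inc.
Qed.

Lemma Kinf_mono rho r s : class_Kinf rho -> 0 <= r -> 0 <= s ->
  (rho r <= rho s) = (r <= s).
Proof.
case=> _ inc _ _ r0 s0; apply/idP/idP.
  by apply: contraTT; rewrite -!ltNge; exact: inc.
by rewrite le_eqVlt => /predU1P[->//|rs]; rewrite ltW// inc.
Qed.

Lemma Kinf_comp rho sigma :
  class_Kinf rho -> class_Kinf sigma -> class_Kinf (rho \o sigma).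
Proof.
move=> Krho Ksigma; have [crho inc ub rho0] := Krho.
have [csigma inc' ub' sigma0] := Ksigma; split.
- apply/subspace_continuousP => x x0.
  have sx0 : `[0, +oo[ (sigma x) by move: x0; rewrite /= !in_itv /= !andbT =>
    /(Kinf_ge0 Ksigma).
  apply: cvg_comp ((subspace_continuousP _ _).1 crho _ sx0).
  apply: cvg_to_within; first exact: (subspace_continuousP _ _).1 csigma _ x0.
  apply: filterS (withinT _ _) => y; rewrite /= !in_itv /= !andbT.
  exact: Kinf_ge0.
- move=> r s r0 rs /=; apply: inc; first exact: Kinf_ge0.
  exact: inc'.
- move=> M; have [r r0 Mr] := ub M; have [s s0 rs] := ub' r.
  by exists s => //; apply: (lt_trans Mr); exact: inc.
- by rewrite /= sigma0.
Qed.

Lemma Kinf_scale (a : R) : 0 < a -> class_Kinf ( *%R a).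
Proof.
move=> a0; split.
- by apply: continuous_subspaceT; exact: mulrl_continuous.
- by move=> r s _ rs; rewrite ltr_pM2l.
- move=> M; exists ((Num.max 0 M + 1) / a).
    by rewrite divr_ge0 ?(ltW a0)// addr_ge0// le_max lexx.
  by rewrite mulrCA divff ?mulr1 ?gt_eqF// ltr_pwDr// le_max lexx orbT.
- by rewrite mulr0.
Qed.

(** Clamping the argument at 0 gives a representative that is continuous on the whole line, so later
    continuity proofs need no subspace topology. *)
Lemma Kinf_extension_continuous rho :
  class_Kinf rho -> continuous (fun x : R => rho (Num.max 0 x)).
Proof.
move=> [/subspace_continuousP crho _ _ _] x.
have x0 : `[0, +oo[ (Num.max 0 x) by rewrite /= in_itv /= andbT le_max lexx.
apply: cvg_comp (crho _ x0); apply: cvg_to_within.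
  by apply: continuous_max; [exact: cvg_cst|exact: cvg_id].
by apply: nearW => y; rewrite /= in_itv /= andbT le_max lexx.
Qed.

Lemma Kinf_inverse rho : class_Kinf rho ->
  exists2 kappa, class_Kinf kappa & forall y, 0 <= y -> rho (kappa y) = y.
Proof.
move=> Krho; have [crho inc ub rho0] := Krho.
have surj y : 0 <= y -> exists2 r, 0 <= r & rho r = y.
  move=> y0; have [r r0 yr] := ub y.
  have [||c] := @IVT R rho 0 r y r0.
  - by apply: continuous_subspaceW crho => s /=; rewrite !in_itv /= => /andP[->].
  - by rewrite rho0 ge_min y0 le_max (ltW yr) orbT.
  - by rewrite in_itv /= => /andP[c0 _] <-; exists c.
have /choice[kappa kappaP] : forall y, exists r, 0 <= y -> 0 <= r /\ rho r = y.
  by move=> y; have [/surj[r r0 <-]|_] := leP 0 y; [exists r|exists 0].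
have kge y : 0 <= y -> 0 <= kappa y by move=> /kappaP[].
have kK y : 0 <= y -> rho (kappa y) = y by move=> /kappaP[].
(* From this comparison and its mirror image follow the continuity, the monotonicity and the
   unboundedness of [kappa], and its value at 0. *)
have kmono r y : 0 <= r -> 0 <= y -> (r < kappa y) = (rho r < y).
  move=> r0 y0; rewrite -[in RHS](kK y y0) !ltNge; congr (~~ _).
  by rewrite (Kinf_mono Krho)// kge.
have kmono' r y : 0 <= r -> 0 <= y -> (kappa y < r) = (y < rho r).
  move=> r0 y0; rewrite -[in RHS](kK y y0) !ltNge; congr (~~ _).
  by rewrite (Kinf_mono Krho)// kge.
exists kappa => //; split.
- apply/subspace_continuousP => y /=; rewrite in_itv /= andbT => y0.
  apply/cvgrPdist_lt => e e0; rewrite /from_subspace.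
  have ltD : y < rho (kappa y + e).
    by rewrite -kmono' ?addr_ge0 ?kge ?(ltW e0)// ltrDl.
  have kz : \forall z \near within `[0, +oo[ (nbhs y), kappa y - e < kappa z.
    (* Below 0 nothing is known about [rho]; there the lower bound follows from [kappa z >= 0]
       instead. *)
    have [lt0|ge0] := ltP (kappa y - e) 0.
      apply: filterS (withinT _ _) => z /=; rewrite in_itv /= andbT => z0.
      exact: lt_le_trans lt0 (kge _ z0).
    have ltB : rho (kappa y - e) < y by rewrite -kmono// ltrBlDr ltrDl.
    near=> z; have z0 : 0 <= z.
      suff : `[0, +oo[ z by rewrite /= in_itv /= andbT.
      by near: z; exact: near_withinT.
    by rewrite kmono//; near: z; apply: cvg_within; exact: lt_nbhsr ltB.
  near=> z; have z0 : 0 <= z.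
    suff : `[0, +oo[ z by rewrite /= in_itv /= andbT.
    by near: z; exact: near_withinT.
  rewrite ltr_distlC; apply/andP; split; first by near: z.
  rewrite kmono' ?addr_ge0 ?kge ?(ltW e0)//.
  by near: z; apply: cvg_within; exact: lt_nbhsl ltD.
- by move=> r s r0 rs; rewrite kmono ?kge ?kK// (le_trans r0) ?ltW.
- move=> M; exists (rho (Num.max 0 M + 1)).
    by apply: Kinf_ge0 => //; rewrite addr_ge0// le_max lexx.
  have M0 : 0 <= Num.max 0 M by rewrite le_max lexx.
  apply: (@le_lt_trans _ _ (Num.max 0 M)); first by rewrite le_max lexx orbT.
  rewrite kmono//; last by apply: Kinf_ge0 => //; rewrite addr_ge0.
  by apply: inc => //; rewrite ltrDl.
- by apply/eqP; rewrite eq_le kge// andbT leNgt kmono// rho0 ltxx.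
Unshelve. all: by end_near. Qed.

Lemma Kinf_positive_definite rho : class_Kinf rho -> positive_definite rho.
Proof.
move=> Krho; have [crho inc _ rho0] := Krho; split => //.
  by move=> r; exact: Kinf_ge0.
move=> r r0; split=> [|->]//; apply: contra_eq => rn0.
by rewrite gt_eqF// -[X in X < _]rho0 inc// lt_def rn0.
Qed.

(** The form of the final UGAS bound: [rho] will be the inverse of the lower bound of V and [sigma]
    its upper bound. The clamp at 0 makes the formula continuous on the whole plane. *)
Lemma KL_of_exponential_decay rho sigma (a c : R) : class_Kinf rho ->
  class_Kinf sigma -> 0 < a -> 0 < c ->
  class_KL (fun s t => rho (a * sigma (Num.max 0 s) * expR (- (c * t)))).
Proof.
move=> Krho Ksigma a0 c0.
pose arg (s t : R) := a * sigma (Num.max 0 s) * expR (- (c * t)).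
have arg_ge0 s t : 0 <= arg s t.
  by rewrite !mulr_ge0 ?expR_ge0 ?(ltW a0)// Kinf_ge0// le_max lexx.
have E : (fun s t => rho (a * sigma (Num.max 0 s) * expR (- (c * t)))) =
         (fun s t => rho (Num.max 0 (arg s t))).
  by apply/funext => s; apply/funext => t; rewrite (max_r (arg_ge0 _ _)).
have crho := Kinf_extension_continuous Krho.
have csig := Kinf_extension_continuous Ksigma.
rewrite E; split.
- apply: continuous_subspaceT => z.
  apply: (@continuous_comp _ _ _ (fun z => arg z.1 z.2)
    (fun x : R => rho (Num.max 0 x))); last exact: crho.
  apply: cvgM.
    apply: cvgM; first exact: cvg_cst.
    apply: (@continuous_comp _ _ _ fst (fun x : R => sigma (Num.max 0 x)));
      last exact: csig.
    exact: cvg_fst.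
  apply: continuous_comp; last exact: continuous_expR.
  apply: cvgN; apply: cvgM; first exact: cvg_cst.
  exact: cvg_snd.
- move=> t t0.
  have -> : (fun s => rho (Num.max 0 (arg s t))) = (rho \o (fun s => arg s t)).
    by apply/funext => s /=; rewrite (max_r (arg_ge0 _ _)).
  apply: Kinf_comp => //.
  have [_ inc ub s0] :=
    Kinf_comp (Kinf_scale (mulr_gt0 a0 (expR_gt0 (- (c * t))))) Ksigma.
  have E1 r : 0 <= r -> arg r t = ( *%R (a * expR (- (c * t))) \o sigma) r.
    by move=> r0; rewrite /arg /= max_r// mulrAC.
  split.
  + apply: continuous_subspaceT => s; apply: cvgM; last exact: cvg_cst.
    by apply: cvgM; [exact: cvg_cst|exact: csig].
  + by move=> r s r0 rs; rewrite !E1 ?(le_trans r0 (ltW rs))//; exact: inc.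
  + by move=> M; have [r r0 Mr] := ub M; exists r => //; rewrite E1.
  + by rewrite E1.
- move=> s t t' s0 t0 tt'; rewrite !max_r// (Kinf_mono Krho)//.
  apply: ler_wpM2l; rewrite ?ler_expR ?lerN2 ?ler_pM2l//.
  by rewrite mulr_ge0 ?(ltW a0)// Kinf_ge0// le_max lexx.
- move=> s s0.
  have E0 : rho (Num.max 0 (a * sigma (Num.max 0 s) * 0)) = 0.
    by rewrite mulr0 maxxx; case: Krho.
  rewrite -[X in _ --> X]E0.
  apply: (cvg_comp (fun t => arg s t) (fun x : R => rho (Num.max 0 x))); last exact: crho.
  apply: cvgM; first exact: cvg_cst.
  apply: (cvg_comp (fun t => c * t) (fun t => expR (- t))); last exact: cvgr_expR.
  exact: gt0_cvgMry.
Qed.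

End class_K_infinity.

(** * Primitives, integrals over segments and monotonicity *)

Section primitives.
Context {R : realType}.
Local Notation mu := (@lebesgue_measure R).
Implicit Types (h F G : R -> R) (a b : R).

Lemma is_derive_continuous F (f : R -> R) :
  (forall x : R, is_derive x 1 F (f x)) -> continuous F.
Proof.
move=> dF x; apply: differentiable_continuous; apply/derivable1_diffP.
by have [] := dF x.
Qed.

Lemma integrable_segment h a b : {within `[a, b], continuous h} ->
  mu.-integrable `[a, b] (EFin \o h).
Proof.
by move=> ch; apply: continuous_compact_integrable => //; exact: segment_compact.
Qed.

Lemma Rintegral_segment0 h a b : b <= a -> \int[mu]_(x in `[a, b]) h x = 0.
Proof.
rewrite le_eqVlt => /predU1P[->|ba]; first by rewrite set_itv1 Rintegral_set1.
by rewrite set_itv_ge ?Rintegral_set0// bnd_simp -ltNge.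
Qed.

Lemma Rintegral_is_derive F h a b : a <= b ->
  (forall x : R, a <= x <= b -> is_derive x 1 F (h x)) ->
  {within `[a, b], continuous h} ->
  \int[mu]_(x in `[a, b]) h x = F b - F a.
Proof.
rewrite le_eqVlt => /predU1P[<- _ _|ab dF ch].
  by rewrite set_itv1 Rintegral_set1 subrr.
have cF x : a <= x <= b -> {for x, continuous F}.
  move=> /dF[dFx _]; apply: differentiable_continuous; exact/derivable1_diffP.
rewrite /Rintegral (@continuous_FTC2 _ h F)//.
- split.
  + move=> x; rewrite in_itv /= => /andP[ax xb].
    by have [] : is_derive x 1 F (h x) by apply: dF; rewrite !ltW.
  + by apply: cvg_at_right_filter; apply: cF; rewrite lexx ltW.
  + by apply: cvg_at_left_filter; apply: cF; rewrite lexx ltW.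
- move=> x; rewrite in_itv /= => /andP[ax xb]; rewrite derive1E.
  by have [] : is_derive x 1 F (h x) by apply: dF; rewrite !ltW.
Qed.

(** The mean value theorem uses only the sign of the derivative inside the segment, which suits a
    derivative along trajectories that may be discontinuous. *)
Lemma is_derive_ndecr F (f : R -> R) a b : a <= b ->
  (forall x : R, a < x < b -> is_derive x 1 F (f x) /\ 0 <= f x) ->
  {within `[a, b], continuous F} -> F a <= F b.
Proof.
rewrite le_eqVlt => /predU1P[->//|ab] dF cF; rewrite -subr_ge0.
have [x||x] := @MVT R F f a b ab.
- by rewrite in_itv /= => /dF[].
- exact: cF.
- rewrite in_itv /= => /dF[_ fx0] ->.
  by rewrite mulr_ge0// subr_ge0 ltW.
Qed.

Lemma primitive_exists h : continuous h ->
  exists F, forall x : R, is_derive x 1 F (h x).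
Proof.
move=> ch.
have ih a b : mu.-integrable `[a, b] (EFin \o h).
  by apply: integrable_segment; exact: continuous_subspaceT.
(* The oriented integral from 0 to [x]: one of the two terms always vanishes. *)
pose F x := \int[mu]_(t in `[0, x]) h t - \int[mu]_(t in `[x, 0]) h t.
have split_int a b c : a <= b -> b <= c ->
    \int[mu]_(t in `[a, c]) h t =
    \int[mu]_(t in `[a, b]) h t + \int[mu]_(t in `[b, c]) h t.
  move=> ab bc; have := @Rintegral_itvB R h (BLeft a) (BRight c) b (ih _ _).
  rewrite !bnd_simp => /(_ ab bc) H.
  rewrite -(@Rintegral_itv_obnd_cbnd _ b) -?H; first by rewrite addrC subrK.
  by apply: integrableS (ih b c) => //; exact: subset_itv_oc_cc.
exists F => x.
(* Lying to the left of both 0 and [x], the point [a] is a base for the fundamental theorem; near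
   [x], [F] differs from the integral from [a] by the constant [G 0]. *)
pose a := Num.min x 0 - 1.
have a0 : a <= 0 by rewrite /a lerBlDr add0r ge_min ler01 orbT.
have ax : a < x by rewrite /a ltrBlDr gt_min ltrDl ltr01.
have xx1 : x < x + 1 by rewrite ltrDl.
have [dG GE] := @continuous_FTC1_closed R h a x (x + 1) xx1 (ih _ _) ax (ch x).
set G := (fun x : R => _) in dG GE.
have dG' : is_derive x 1 (G - cst (G 0)) (h x).
  rewrite -[h x]subr0; apply: is_deriveB.
  by split => //; rewrite -derive1E.
apply: near_eq_is_derive dG' => //.
near=> y.
have ay : a <= y by apply: ltW; near: y; exact: lt_nbhsr.
rewrite /F !fctE /G; have [y0|y0] := leP 0 y.
  by rewrite (Rintegral_segment0 _ y0) subr0 (split_int _ _ _ a0 y0) addrAC subrr add0r.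
rewrite (Rintegral_segment0 _ (ltW y0)) (split_int _ _ _ ay (ltW y0)).
by rewrite opprD addrA subrr.
Unshelve. all: by end_near. Qed.

End primitives.

(** * Construction of the rescaling function *)

Section rescaling.
Context {R : realType}.
Implicit Types (k mu : R -> R).

(* The function k(v) = exp(c L(v)), with L a primitive of 1/mu, satisfies
   mu k' = c k. It is C^1 up to v = 0 as soon as c >= 2 sup_[0,1] |mu'|: then
   k(v) / (v mu(v)) is nondecreasing on ]0, 1], so that k(v) = O(v^2). *)
Lemma rescaling_exists mu : positive_definite mu -> C1_halfline mu ->
  (\int[lebesgue_measure]_(l in `[1, r]) (mu l)^-1) @[r --> +oo] --> +oo ->
  exists (k k' : R -> R) (c : R),
    [/\ class_Kinf k, 0 < c, continuous k',
        forall v : R, is_derive v 1 k (k' v)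
      & forall v, 0 <= v -> 0 <= k' v /\ k' v * mu v = c * k v].
Proof.
move=> [/subspace_continuousP cmu mu_ge0 mu_eq0] [dmu cmu'] mu_div.
have mu_gt0 (v : R) : 0 < v -> 0 < mu v.
  move=> v0; rewrite lt_def mu_ge0 ?(ltW v0)// andbT; apply/eqP.
  by move=> /(mu_eq0 _ (ltW v0)).1 v0'; rewrite v0' ltxx in v0.
have mu0 : mu 0 = 0 by exact/mu_eq0.
pose mu' := derive_from 0 mu.
have dmuE (v : R) : 0 < v -> is_derive v 1 mu (mu' v).
  by move=> v0; apply: (@dquot_is_derive _ 0) => //; apply: dmu; exact: ltW.
have cmuv (v : R) : 0 < v -> {for v, continuous mu}.
  move=> /dmuE[dv _]; apply: differentiable_continuous; exact/derivable1_diffP.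
have [K K1 muK] : exists2 K, 0 < K & forall v, 0 <= v <= 1 -> mu' v <= K.
  have [|v _ vmax] := @EVT_max R mu' 0 1 ler01.
    apply: continuous_subspaceW cmu' => s /=.
    by rewrite !in_itv /= => /andP[->].
  exists (Num.max 1 (mu' v)); first by rewrite lt_max ltr01.
  by move=> w w01; rewrite le_max vmax ?orbT// in_itv.
have mu_le (v : R) : 0 < v <= 1 -> mu v <= K * v.
  move=> /andP[v0 v1].
  have [x||w] := @MVT R mu mu' 0 v v0.
  - by rewrite in_itv /= => /andP[x0 _]; exact: dmuE.
  - apply: continuous_subspaceW (_ : {within `[0, +oo[, continuous mu}).
      by move=> s /=; rewrite !in_itv /= => /andP[->].
    exact/subspace_continuousP.
  rewrite in_itv /= mu0 !subr0 => /andP[w0 wv] ->.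
  by rewrite ler_pM2r// muK// (ltW w0) (le_trans (ltW wv)).
(* The substitution v = exp u replaces 1/mu on the open half-line by a function continuous on the
   whole line, which has a global primitive [H]; then L = H(ln v). *)
pose g u : R := expR u / mu (expR u).
have cg : continuous g.
  move=> u; apply: cvgM; first exact: continuous_expR.
  apply: cvgV; first by rewrite gt_eqF// mu_gt0// expR_gt0.
  apply: (cvg_comp (@expR R) mu); first exact: continuous_expR.
  exact: cmuv (expR_gt0 _).
have [H dH] := primitive_exists cg.
pose L v := H (ln v).
have dL (v : R) : 0 < v -> is_derive v 1 L (mu v)^-1.
  move=> v0; have dln := is_derive1_ln v0.
  have -> : (mu v)^-1 = g (ln v) * v^-1.
    by rewrite /g lnK// mulrAC divff ?mul1r// gt_eqF.
  exact: (@is_derive1_comp _ H (@ln R)).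
(* The derivative of the logarithm of k(v) / (v mu(v)) is (c - mu'(v)) / mu(v) - 1/v. On ]0, 1] one
   [K] dominates mu'(v), the other mu(v)/v. *)
pose c := 2 * K.
have c0 : 0 < c by rewrite mulr_gt0.
(* Vanishing on the negative half-line makes the derivative of [k] at 0 two-sided; subtracting [L 1]
   normalizes [k] to k(1) = 1. *)
pose k (v : R) : R := if 0 < v then expR (c * (L v - L 1)) else 0.
pose k' (v : R) : R := if 0 < v then c * k v / mu v else 0.
have kE (v : R) : 0 < v -> k v = expR (c * (L v - L 1)) by rewrite /k => ->.
have kk' (v : R) : 0 < v -> is_derive v 1 k (k' v).
  move=> v0; pose e := fun v => expR (c * (L v - L 1)).
  have de : is_derive v 1 e (k' v).
    rewrite /k' v0 kE// mulrAC mulrC [c / _]mulrC.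
    have dlin : is_derive v 1 (fun v => c * (L v - L 1)) ((mu v)^-1 * c).
      rewrite mulrC -[X in c * X]subr0.
      apply: (@is_deriveZ _ _ _ (L - cst (L 1)) c); apply: is_deriveB; exact: dL.
    exact: (@is_derive1_comp _ expR _ v).
  apply: near_eq_is_derive de; near=> w; rewrite /k ifT//.
  by near: w; exact: lt_nbhsr.
have dln_ratio (v : R) : 0 < v -> is_derive v 1
   (fun v => c * L v - ln (mu v) - ln v) (c / mu v - mu' v / mu v - v^-1).
  move=> v0; apply: (@is_deriveB _ _ _ (fun v => c * L v - ln (mu v)) (@ln R));
    last exact: is_derive1_ln.
  apply: (@is_deriveB _ _ _ (fun v => c * L v) (fun v => ln (mu v))).
    by apply: (@is_deriveZ _ _ _ L c); exact: dL.
  rewrite [mu' v / _]mulrC.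
  have dlnmu := is_derive1_ln (mu_gt0 _ v0).
  have dmuv := dmuE _ v0.
  exact: (@is_derive1_comp _ (@ln R) mu).
have k_le (v : R) : 0 < v <= 1 -> k v <= v * mu v / mu 1.
  move=> /andP[v0 v1].
  have L_le : c * L v - ln (mu v) - ln v <= c * L 1 - ln (mu 1) - ln 1.
    apply: (@is_derive_ndecr R (fun v => c * L v - ln (mu v) - ln v)
      (fun v => c / mu v - mu' v / mu v - v^-1) v 1) => //.
      move=> w /andP[vw w1]; have w0 := lt_trans v0 vw; split.
        exact: dln_ratio.
      have muw := mu_gt0 _ w0.
      rewrite -mulrBl subr_ge0 -(ler_pM2r muw) mulrVK ?unitfE ?gt_eqF//.
      rewrite -(ler_pM2l w0) mulrA divff ?gt_eqF// mul1r.
      apply: (le_trans (mu_le _ _)); first by rewrite w0 ltW.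
      rewrite mulrC ler_pM2l//.
      have : mu' w <= K by rewrite muK// !ltW.
      by rewrite /c; lra.
    apply: derivable_within_continuous => w; rewrite in_itv /= => /andP[vw _].
    by have [] := dln_ratio w (lt_le_trans v0 vw).
  rewrite kE// -ler_ln ?posrE ?expR_gt0 ?divr_gt0 ?mulr_gt0 ?mu_gt0//.
  rewrite expRK ln_div ?lnM ?posrE ?mulr_gt0 ?mu_gt0//.
  by move: L_le; rewrite ln1 mulrBr; lra.
have k'0 (v : R) : v <= 0 -> k' v = 0 by rewrite /k' leNgt => /negbTE ->.
have k0 (v : R) : v <= 0 -> k v = 0 by rewrite /k leNgt => /negbTE ->.
have k_ge0 (v : R) : 0 <= k v by rewrite /k; case: ifP => // _; exact: expR_ge0.
have k'_ge0 (v : R) : 0 <= k' v.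
  have [v0|v0] := ltP 0 v; last by rewrite k'0.
  rewrite /k' v0; apply: divr_ge0; last exact: ltW (mu_gt0 _ v0).
  by apply: mulr_ge0 => //; exact: ltW.
(* This quadratic bound makes [k] differentiable at 0 with derivative 0; the linear bound on [k']
   below makes [k'] continuous there. *)
have k_sq (v : R) : `|v| <= 1 -> k v <= (K / mu 1) * `|v| ^+ 2.
  move=> v1; have [v0|v0] := ltP 0 v; last first.
    by rewrite k0// mulr_ge0 ?sqr_ge0// divr_ge0 ?mu_ge0 ?ltW.
  rewrite gtr0_norm// in v1 *; rewrite (le_trans (k_le _ _)) ?v0//.
  have -> : K / mu 1 * v ^+ 2 = K * v * v / mu 1 by rewrite expr2; ring.
  by rewrite ler_pM2r ?invr_gt0 ?mu_gt0// [v * _]mulrC ler_pM2r// mu_le// v0.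
have k'_lin (v : R) : `|v| <= 1 -> k' v <= (c / mu 1) * `|v|.
  move=> v1; have [v0|v0] := ltP 0 v; last first.
    by rewrite k'0// mulr_ge0// divr_ge0 ?mu_ge0 ?ltW.
  rewrite gtr0_norm// in v1 *; rewrite /k' v0 ler_pdivrMr ?mu_gt0//.
  have -> : c / mu 1 * v * mu v = c * (v * mu v / mu 1) by ring.
  by rewrite ler_pM2l// k_le// v0.
have dk (v : R) : is_derive v 1 k (k' v).
  have [v0|] := ltP 0 v; first exact: kk'.
  rewrite le_eqVlt => /predU1P[->|v0].
    rewrite k'0//; apply/is_derive_quotP.
    apply/cvgrPdist_le => e e0; near=> s.
    rewrite /= (k0 0)// !subr0 sub0r normrN normrM (ger0_norm (k_ge0 s)) normfV.
    have s0 : 0 < `|s| by rewrite normr_gt0; near: s; exact: nbhs_dnbhs_neq.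
    rewrite mulrC ler_pdivrMr// (le_trans (k_sq _ _))//.
      by near: s; exact: dnbhs0_le.
    rewrite expr2 mulrA ler_pM2r// -ler_pdivlMl ?divr_gt0 ?mu_gt0//.
    by near: s; apply: dnbhs0_le; rewrite mulr_gt0 ?invr_gt0 ?divr_gt0 ?mu_gt0.
  have d0 : is_derive v 1 (cst 0 : R -> R) 0 by exact: is_derive_cst.
  rewrite k'0 ?ltW//; apply: near_eq_is_derive d0; near=> w.
  by rewrite k0//; apply: ltW; near: w; exact: lt_nbhsl.
have near0 (e : R) : 0 < e -> \forall s \near nbhs (0 : R), `|s| <= e.
  by move=> e0; exists e => //= s /=; rewrite sub0r normrN => /ltW.
have ck : continuous k by exact: is_derive_continuous dk.
exists k, k', c; split => //.
- split.
  + exact: continuous_subspaceT.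
  + move=> r s r0 rs; have s0 := le_lt_trans r0 rs.
    rewrite [ltRHS]kE//; move: r0; rewrite le_eqVlt => /predU1P[<-|r0].
      by rewrite k0// expR_gt0.
    rewrite kE// ltr_expR ltr_pM2l// ltrD2r.
    have [x||x] := @MVT R L (fun v => (mu v)^-1) r s rs.
    * by rewrite in_itv /= => /andP[rx _]; apply: dL; exact: lt_trans rx.
    * apply: derivable_within_continuous => w; rewrite in_itv /= => /andP[rw _].
      by have [] := dL w (lt_le_trans r0 rw).
    * rewrite in_itv /= => /andP[rx _] E; rewrite -subr_gt0 E.
      by rewrite mulr_gt0 ?subr_gt0// invr_gt0 mu_gt0// (lt_trans r0).
  + move=> M; near (+oo : set_system R) => r.
    have r1 : 1 <= r by near: r; apply: nbhs_pinfty_ge; rewrite num_real.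
    exists r; first exact: le_trans r1.
    rewrite kE ?(lt_le_trans ltr01)//.
    (* The divergence hypothesis enters here: [L r - L 1] is the given integral, and exp x >= 1 + x
       transfers its unboundedness to [k]. *)
    have -> : L r - L 1 = \int[lebesgue_measure]_(l in `[1, r]) (mu l)^-1.
      symmetry; apply: Rintegral_is_derive => // [w /andP[w1 _]|].
        by apply: dL; exact: lt_le_trans w1.
      apply: derivable_within_continuous => w; rewrite in_itv /= => /andP[w1 _].
      have w0 := lt_le_trans ltr01 w1.
      apply: derivableV; first by rewrite gt_eqF// mu_gt0.
      by have [] := dmuE _ w0.
    apply: lt_le_trans (expR_ge1Dx _).
    rewrite -ltrBlDl -ltr_pdivrMl//; near: r.
    by move/cvgryPgt : mu_div; apply.
  + exact: k0.
- move=> v; have [v0|] := ltP 0 v.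
    apply: (@cvg_trans _ (c * k w / mu w @[w --> v])).
      apply: near_eq_cvg; near=> w; rewrite /k' ifT//.
      by near: w; exact: lt_nbhsr.
    rewrite /k' v0; apply: (@cvgM _ _ (nbhs v) _ (fun w => c * k w)
      (fun w => (mu w)^-1)).
      by apply: (@cvgM _ _ (nbhs v) _ (fun=> c) k); [exact: cvg_cst|exact: ck].
    by apply: cvgV; [rewrite gt_eqF// mu_gt0|exact: cmuv].
  rewrite le_eqVlt => /predU1P[->|v0].
    rewrite /continuous_at k'0//.
    apply/(@cvgrPdist_le _ _ _ (nbhs (0 : R))) => e e0; near=> s.
    have s1 : `|s| <= 1 by near: s; exact: near0.
    rewrite sub0r normrN ger0_norm// (le_trans (k'_lin _ s1))//.
    rewrite -ler_pdivlMl ?divr_gt0 ?mu_gt0//.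
    by near: s; apply: near0; rewrite mulr_gt0 ?invr_gt0 ?divr_gt0 ?mu_gt0.
  rewrite /continuous_at k'0 ?ltW//.
  apply/(@cvgrPdist_le _ _ _ (nbhs (v : R))) => e e0; near=> w.
  rewrite k'0 ?subrr ?normr0 ?ltW//.
  by near: w; exact: lt_nbhsl.
- move=> v v0; split => //.
  move: v0; rewrite le_eqVlt => /predU1P[<-|v0]; first by rewrite k'0// k0// mul0r mulr0.
  by rewrite /k' v0 divfK// gt_eqF// mu_gt0.
Unshelve. all: by end_near. Qed.
End rescaling.

(** * Strict differentiability from continuous partial derivatives *)

Section strict_differentiability.
Context {R : realType}.

Lemma dotDr n (G u v : 'rV[R]_n) : dot G (u + v) = dot G u + dot G v.
Proof. by rewrite /dot -big_split; apply: eq_bigr => i _; rewrite mxE mulrDr. Qed.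

Lemma dotZr n (G u : 'rV[R]_n) (a : R) : dot G (a *: u) = a * dot G u.
Proof. by rewrite /dot mulr_sumr; apply: eq_bigr => i _; rewrite mxE mulrCA. Qed.

Lemma dotZl n (G u : 'rV[R]_n) (a : R) : dot (a *: G) u = a * dot G u.
Proof. by rewrite /dot mulr_sumr; apply: eq_bigr => i _; rewrite mxE mulrA. Qed.

Lemma dot_delta n (G : 'rV[R]_n) i : dot G (delta_mx 0 i) = G 0 i.
Proof.
rewrite /dot (bigD1 i)//= mxE !eqxx mulr1 big1 ?addr0// => j ji.
by rewrite mxE eqxx (negbTE ji) mulr0.
Qed.

Lemma dot0 n (G : 'rV[R]_n) : dot G 0 = 0.
Proof. by rewrite /dot big1// => i _; rewrite mxE mulr0. Qed.

Lemma dot_le n (G u : 'rV[R]_n) N : (forall i, `|u 0 i| <= N) ->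
  `|dot G u| <= (\sum_i `|G 0 i|) * N.
Proof.
move=> uN; rewrite /dot (le_trans (ler_norm_sum _ _ _))// mulr_suml.
by apply: ler_sum => i _; rewrite normrM ler_wpM2l.
Qed.

Lemma cvg_dot n (X : Type) (F : set_system X) {FF : Filter F}
    (G u : X -> 'rV[R]_n) (G' u' : 'rV[R]_n) :
  G s @[s --> F] --> G' -> u s @[s --> F] --> u' ->
  dot (G s) (u s) @[s --> F] --> dot G' u'.
Proof.
move=> cG cu; apply: cvg_big => [|i _]; first exact: add_continuous.
have coord (v : X -> 'rV[R]_n) (v' : 'rV[R]_n) :
    v s @[s --> F] --> v' -> v s 0 i @[s --> F] --> v' 0 i.
  move=> cv; apply: (cvg_comp v (fun w : 'rV[R]_n => w 0 i)) cv _.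
  exact: coord_continuous.
by apply: cvgM; exact: coord.
Qed.

Lemma MVT_error (F f : R -> R) a b D e : a <= b ->
  (forall x : R, a < x < b -> is_derive x 1 F (f x) /\ `|f x - D| <= e) ->
  {within `[a, b], continuous F} ->
  `|F b - F a - D * (b - a)| <= e * `|b - a|.
Proof.
rewrite le_eqVlt => /predU1P[->|ab] dF cF.
  by rewrite !subrr mulr0 subrr normr0 mulr0.
have [x||x] := @MVT R F f a b ab.
- by rewrite in_itv /= => /dF[].
- exact: cF.
- rewrite in_itv /= => /dF[_ fx0] ->.
  by rewrite -mulrBl normrM ler_wpM2r.
Qed.

Lemma is_derive_line n (g : 'rV[R]_n -> R) (x v : 'rV[R]_n) (s : R) :
  derivable g (s *: v + x) v ->
  is_derive s 1 (fun s : R => g (s *: v + x)) ('D_v g (s *: v + x)).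
Proof.
set F := fun s : R => g (s *: v + x).
have E : (fun h : R => h^-1 *: ((F \o shift s) (h *: 1) - F s)) =
    (fun h : R => h^-1 *: ((g \o shift (s *: v + x)) (h *: v) - g (s *: v + x))).
  apply/funext => h; rewrite /F /= [h *: 1]mulr1.
  by rewrite scalerDl addrA.
by move=> dg; split; rewrite /derivable /derive E.
Qed.

(* y is reached from y' by changing one coordinate at a time, so that only the
   existence and the size of the partial derivatives are used. *)
Lemma grad_error n (g : 'rV[R]_n -> R) (x0 G : 'rV[R]_n) (r e : R) :
  (forall y, ball x0 r y -> has_grad g y /\ forall i, `|grad g y 0 i - G 0 i| <= e) ->
  forall y y' N, ball x0 r y -> ball x0 r y' -> (forall i, `|y 0 i - y' 0 i| <= N) ->
  `|g y - g y' - dot G (y - y')| <= n%:R * (e * N).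
Proof.
move=> dg y y' N xy xy' yN.
pose z k : 'rV[R]_n := \row_i (if (i < k)%N then y 0 i else y' 0 i).
suff H k : (k <= n)%N ->
    `|g (z k) - g y' - dot G (z k - y')| <= k%:R * (e * N).
  have zn : z n = y by apply/rowP => i; rewrite mxE ltn_ord.
  by have := H n (leqnn n); rewrite zn.
elim: k => [_|k IH kn].
  have -> : z 0%N = y' by apply/rowP => i; rewrite mxE.
  by rewrite !subrr dot0 subr0 normr0 mul0r.
pose i0 := Ordinal kn; pose d := y 0 i0 - y' 0 i0.
pose v : 'rV[R]_n := delta_mx 0 i0.
have zS : z k.+1 = d *: v + z k.
  apply/rowP => i; rewrite !mxE ltnS leq_eqVlt; case: eqVneq => [ik|ik] /=.
    have -> : i = i0 by exact: val_inj.
    by rewrite !eqxx ltnn mulr1 subrK.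
  have -> : (i == i0) = false by apply/negbTE; apply: contra ik => /eqP ->.
  by rewrite mulr0 add0r.
(* The ball is that of the sup norm, hence a product of intervals: every coordinate of the moving
   point lies between those of [y'] and [y]. *)
have zball s : Num.min 0 d <= s <= Num.max 0 d -> ball x0 r (s *: v + z k).
  move=> /andP[s1 s2]; split=> [|i j]; first by case: xy.
  rewrite ord1; have := xy.2 0 j; have := xy'.2 0 j; rewrite /ball /= !mxE eqxx /=.
  case: ifP => jk.
    rewrite (_ : (j == i0) = false) ?mulr0 ?add0r//.
    by apply/negbTE; rewrite -val_eqE /= ltn_eqF.
  case: eqVneq => [->|_]; last by rewrite mulr0 add0r.
  rewrite mulr1 !ltr_distl => /andP[h1 h2] /andP[h3 h4].
  by move: s1 s2; rewrite /d ge_min le_max => /orP[] ? /orP[] ?; lra.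
have step : `|g (z k.+1) - g (z k) - G 0 i0 * d| <= e * N.
  have dF s : Num.min 0 d <= s <= Num.max 0 d ->
      is_derive s 1 (fun s : R => g (s *: v + z k)) ('D_v g (s *: v + z k)) /\
      `|'D_v g (s *: v + z k) - G 0 i0| <= e.
    move=> /zball /dg[hg hG]; split; first by apply: is_derive_line; exact: hg.
    by have := hG i0; rewrite mxE.
  have e0 : 0 <= e.
    by have [|_] := dF 0; [rewrite ge_min le_max lexx|exact: le_trans].
  apply: (@le_trans _ _ (e * `|d|)); last by apply: ler_wpM2l => //; exact: yN.
  have z0 : z k = 0 *: v + z k by rewrite scale0r add0r.
  have cF a b : Num.min 0 d <= a -> b <= Num.max 0 d ->
      {within `[a, b], continuous (fun s : R => g (s *: v + z k))}.
    move=> ha hb; apply: derivable_within_continuous => s.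
    rewrite in_itv /= => /andP[as_ sb].
    have sd : Num.min 0 d <= s <= Num.max 0 d.
      by rewrite (le_trans ha as_) (le_trans sb hb).
    by have [[]] := dF s sd.
  rewrite zS [in X in _ - g X - _]z0.
  have [d0|d0] := leP 0 d.
    have := @MVT_error (fun s : R => g (s *: v + z k))
      (fun s : R => 'D_v g (s *: v + z k)) 0 d (G 0 i0) e d0.
    rewrite subr0; apply=> [s /andP[s0 sd]|].
      by apply: dF; rewrite ge_min le_max (ltW s0) (ltW sd) orbT.
    by apply: cF; rewrite ?ge_min ?le_max lexx ?orbT.
  have := @MVT_error (fun s : R => g (s *: v + z k))
    (fun s : R => 'D_v g (s *: v + z k)) d 0 (G 0 i0) e (ltW d0).
  rewrite sub0r normrN mulrN opprK => H.
  rewrite -normrN opprD opprB opprK; apply: H => [s /andP[s0 sd]|].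
    by apply: dF; rewrite ge_min le_max (ltW s0) (ltW sd) orbT.
  by apply: cF; rewrite ?ge_min ?le_max lexx ?orbT.
have -> : g (z k.+1) - g y' - dot G (z k.+1 - y') =
    (g (z k) - g y' - dot G (z k - y')) + (g (z k.+1) - g (z k) - G 0 i0 * d).
  suff -> : dot G (z k.+1 - y') = dot G (z k - y') + G 0 i0 * d by ring.
  rewrite zS -addrA (dotDr G (d *: v)) dotZr /v dot_delta.
  ring.
rewrite (le_trans (ler_normD _ _))// -natr1 mulrDl mul1r lerD// IH//.
exact: ltnW.
Qed.

Section C1.
Variables (n d : nat) (V : 'rV[R]_n -> R -> 'rV[R]_d -> R).
Hypothesis VC1 : C1_xttau V.

Local Notation D x0 t0 tau0 x t tau :=
  (dot (V_x V x0 t0 tau0) x + V_t V x0 t0 tau0 * t + dot (V_tau V x0 t0 tau0) tau).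

Lemma within_cvg_ball (W : pseudoMetricType R)
    (G : 'rV[R]_n * R * 'rV[R]_d -> W) x0 (t0 : R) tau0 (e : R) :
  {within [set z : 'rV[R]_n * R * 'rV[R]_d | 0 <= z.1.2], continuous G} ->
  0 <= t0 -> 0 < e ->
  exists2 r : R, 0 < r & forall x (t : R) tau, ball x0 r x -> ball t0 r t ->
    ball tau0 r tau -> 0 <= t -> ball (G (x0, t0, tau0)) e (G (x, t, tau)).
Proof.
move=> /subspace_continuousP cG t00 e0.
have /cvg_ballP/(_ e e0) := cG (x0, t0, tau0) t00.
rewrite near_withinE => /nbhs_ballP[r /= r0 rG].
exists r => // x t tau xx tt tautau t0'.
exact: (rG (x, t, tau) (conj (conj xx tt) tautau) t0').
Qed.

(* The form of differentiability behind both the joint continuity of V and the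
   chain rule along curves that leave t = 0; N bounds the sup norm of the
   increment. *)
Lemma C1_strictly_differentiable x0 (t0 : R) tau0 (e : R) : 0 <= t0 -> 0 < e ->
  exists2 r : R, 0 < r & forall (x : 'rV[R]_n) (t : R) (tau : 'rV[R]_d)
      (x' : 'rV[R]_n) (t' : R) (tau' : 'rV[R]_d) (N : R),
    [/\ ball x0 r x, ball t0 r t & ball tau0 r tau] ->
    [/\ ball x0 r x', ball t0 r t' & ball tau0 r tau'] ->
    0 <= t -> 0 <= t' -> (forall i, `|x 0 i - x' 0 i| <= N) -> `|t - t'| <= N ->
    (forall i, `|tau 0 i - tau' 0 i| <= N) ->
    `|V x t tau - V x' t' tau' - D x0 t0 tau0 (x - x') (t - t') (tau - tau')|
      <= e * N.
Proof.
move=> t00 e0; have [dV cVx cVt cVtau] := VC1.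
(* The path changes the [n] coordinates of x, then t, then the [d] coordinates of tau; each of these
   n + 1 + d moves costs at most [e1 * N]. *)
pose e1 := e / (n%:R + 1 + d%:R).
have nd0 : 0 < n%:R + 1 + d%:R :> R by rewrite ltr_wpDr// ltr_wpDl.
have e10 : 0 < e1 by rewrite divr_gt0.
have [r1 r10 H1] := within_cvg_ball x0 tau0 cVx t00 e10.
have [r2 r20 H2] := within_cvg_ball x0 tau0 cVt t00 e10.
have [r3 r30 H3] := within_cvg_ball x0 tau0 cVtau t00 e10.
pose r := Num.min r1 (Num.min r2 r3).
have rr1 : r <= r1 by rewrite ge_min lexx.
have rr2 : r <= r2 by rewrite !ge_min lexx orbT.
have rr3 : r <= r3 by rewrite !ge_min lexx !orbT.
exists r; first by rewrite !lt_min r10 r20.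
move=> x t tau x' t' tau' N [xx tt tautau] [xx' tt' tautau'] t_ge0 t'_ge0 xN tN tauN.
have E1 : `|V x t tau - V x' t tau - dot (V_x V x0 t0 tau0) (x - x')|
    <= n%:R * (e1 * N).
  apply: (@grad_error _ (fun y => V y t tau) x0 _ r) => // y xy.
  split; first by have [] := dV y t tau t_ge0.
  move=> i.
  have := H1 y t tau (le_ball rr1 xy) (le_ball rr1 tt) (le_ball rr1 tautau) t_ge0.
  by move=> [_ /(_ 0 i)]; rewrite /ball /= distrC => /ltW.
have E3 : `|V x' t' tau - V x' t' tau' - dot (V_tau V x0 t0 tau0) (tau - tau')|
    <= d%:R * (e1 * N).
  apply: (@grad_error _ (V x' t') tau0 _ r) => // y xy.
  split; first by have [] := dV x' t' y t'_ge0.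
  move=> i.
  have := H3 x' t' y (le_ball rr3 xx') (le_ball rr3 tt') (le_ball rr3 xy) t'_ge0.
  by move=> [_ /(_ 0 i)]; rewrite /ball /= distrC => /ltW.
(* At time 0 only a right derivative exists, but the mean value theorem asks for a derivative inside
   the segment and mere continuity at its ends. *)
have dt (s : R) : 0 < s -> is_derive s 1 (fun s => V x' s tau) (V_t V x' s tau).
  move=> s0; apply: (@dquot_is_derive _ 0) => //.
  by have [_ + _] := dV x' s tau (ltW s0); exact.
have ct : {within `[0, +oo[, continuous (fun s => V x' s tau)}.
  apply/subspace_continuousP => s; rewrite /= in_itv /= andbT => s0.
  by have [_ dVt _] := dV x' s tau s0; exact: dquot_continuous dVt.
have E2' (a b : R) : 0 <= a -> a <= b -> ball t0 r a -> ball t0 r b ->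
    `|V x' b tau - V x' a tau - V_t V x0 t0 tau0 * (b - a)| <= e1 * `|b - a|.
  move=> a0 ab ra rb.
  apply: (@MVT_error (fun s => V x' s tau) (fun s => V_t V x' s tau)) => //.
    move=> s /andP[as_ sb]; split; first by apply: dt; exact: le_lt_trans as_.
    have s0 : 0 <= s by rewrite (le_trans a0)// ltW.
    have ts : ball t0 r s.
      move: ra rb; rewrite /ball /= !ltr_distl => /andP[? ?] /andP[? ?].
      by apply/andP; split; lra.
    have := H2 x' s tau (le_ball rr2 xx') (le_ball rr2 ts) (le_ball rr2 tautau) s0.
    by rewrite /ball /= distrC => /ltW.
  apply: continuous_subspaceW ct => s /=.
  by rewrite !in_itv /= andbT => /andP[/(le_trans a0)].
have E2 : `|V x' t tau - V x' t' tau - V_t V x0 t0 tau0 * (t - t')| <= e1 * N.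
  apply: (@le_trans _ _ (e1 * `|t - t'|)); last by rewrite ler_pM2l.
  have [tt0|tt0] := leP t' t; first exact: E2'.
  rewrite [`|t - t'|]distrC -[leLHS]normrN.
  have -> : - (V x' t tau - V x' t' tau - V_t V x0 t0 tau0 * (t - t')) =
    V x' t' tau - V x' t tau - V_t V x0 t0 tau0 * (t' - t) by ring.
  by apply: E2' => //; exact: ltW.
have -> : e * N = n%:R * (e1 * N) + e1 * N + d%:R * (e1 * N).
  by rewrite /e1; field; rewrite gt_eqF.
have -> : V x t tau - V x' t' tau' - D x0 t0 tau0 (x - x') (t - t') (tau - tau') =
   (V x t tau - V x' t tau - dot (V_x V x0 t0 tau0) (x - x')) +
   (V x' t tau - V x' t' tau - V_t V x0 t0 tau0 * (t - t')) +
   (V x' t' tau - V x' t' tau' - dot (V_tau V x0 t0 tau0) (tau - tau')) by ring.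
rewrite (le_trans (ler_normD _ _))// lerD// (le_trans (ler_normD _ _))//.
exact: lerD.
Qed.

(** [C1_xttau] speaks of partial derivatives only, so joint continuity has to be earned: strict
    differentiability with error 1 gives a linear bound on increments from the base point. *)
Lemma C1_continuous :
  {within [set z : 'rV[R]_n * R * 'rV[R]_d | 0 <= z.1.2],
    continuous (fun z => V z.1.1 z.1.2 z.2)}.
Proof.
apply/subspace_continuousP => -[[x0 t0] tau0] /= t00.
have [r r0 H] := @C1_strictly_differentiable x0 t0 tau0 1 t00 ltr01.
apply/cvgrPdist_le => e e0.
(* The l1 sizes of the three partial gradients bound the linear part; the final 1 pays for the error
   term. *)
pose C := \sum_i `|V_x V x0 t0 tau0 0 i| + `|V_t V x0 t0 tau0|
          + \sum_i `|V_tau V x0 t0 tau0 0 i| + 1.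
have C0 : 0 < C by rewrite ltr_wpDl// !addr_ge0// sumr_ge0.
pose N := Num.min r (e / C).
have N0 : 0 < N by rewrite lt_min r0 divr_gt0.
have Nr : N <= r by rewrite ge_min lexx.
rewrite near_withinE; apply/nbhs_ballP; exists N => // -[[x t] tau] /=.
move=> [[/= xx tt] tautau] t_ge0.
have xN i : `|x0 0 i - x 0 i| <= N by apply: ltW; case: xx => _ /(_ 0 i).
have tN : `|t0 - t| <= N by exact: ltW.
have tauN i : `|tau0 0 i - tau 0 i| <= N by apply: ltW; case: tautau => _ /(_ 0 i).
have := H x0 t0 tau0 x t tau N; rewrite mul1r => /(_ _ _ t00 t_ge0 xN tN tauN) H'.
apply: (@le_trans _ _ (C * N)); last first.
  by rewrite -ler_pdivlMl// mulrC ge_min lexx orbT.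
rewrite -[V x0 t0 tau0 - _](subrK (D x0 t0 tau0 (x0 - x) (t0 - t) (tau0 - tau))).
rewrite (le_trans (ler_normD _ _))// /C mulrDl mul1r addrC lerD//; last first.
  by apply: H'; split; try exact: ballxx; exact: (le_ball Nr).
rewrite !mulrDl (le_trans (ler_normD _ _))// lerD//; last first.
  by apply: dot_le => i; rewrite !mxE.
rewrite (le_trans (ler_normD _ _))// lerD//.
  by apply: dot_le => i; rewrite !mxE.
by rewrite normrM ler_wpM2l.
Qed.

Lemma chain_rule (F : set_system R) {FF : ProperFilter F} (t0 : R)
    (x : R -> 'rV[R]_n) (tau : R -> 'rV[R]_d) x' tau' :
  0 <= t0 -> F --> t0^' -> (\forall s \near F, 0 <= s) ->
  (s - t0)^-1 *: (x s - x t0) @[s --> F] --> x' ->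
  (s - t0)^-1 *: (tau s - tau t0) @[s --> F] --> tau' ->
  (s - t0)^-1 *: (V (x s) s (tau s) - V (x t0) t0 (tau t0)) @[s --> F] -->
    D (x t0) t0 (tau t0) x' 1 tau'.
Proof.
move=> t00 Ft F0 dx dtau.
have Ft0 : F --> t0 by apply: cvg_trans Ft (@nbhs_dnbhs _ t0).
have cx := @quot_cvg_continuous _ F FF t0 Ft0 _ _ _ dx.
have ctau := @quot_cvg_continuous _ F FF t0 Ft0 _ _ _ dtau.
(* Eventually [M] bounds all coordinates of both difference quotients, and being at least 1 it also
   covers the time increment: every increment is at most M |s - t0|. *)
pose M : R := \sum_i `|x' 0 i| + \sum_i `|tau' 0 i| + 1.
have M1 : 1 <= M by rewrite lerDr addr_ge0// sumr_ge0.
have M0 : 0 < M by exact: lt_le_trans M1.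
(* The differential applied to the difference quotients; it has the desired limit, so only its
   distance to the quotient of V remains to be estimated. *)
pose L s := D (x t0) t0 (tau t0) ((s - t0)^-1 *: (x s - x t0)) 1
              ((s - t0)^-1 *: (tau s - tau t0)).
have cL : L s @[s --> F] --> D (x t0) t0 (tau t0) x' 1 tau'.
  apply: cvgD; last by apply: cvg_dot => //; exact: cvg_cst.
  by apply: cvgD; [apply: cvg_dot => //; exact: cvg_cst|exact: cvg_cst].
rewrite -[X in _ --> X]add0r.
have -> : (fun s => (s - t0)^-1 *: (V (x s) s (tau s) - V (x t0) t0 (tau t0))) =
   (fun s => ((s - t0)^-1 *: (V (x s) s (tau s) - V (x t0) t0 (tau t0)) - L s) + L s).
  by apply/funext => s; rewrite subrK.
apply: cvgD => //; apply/cvgrPdist_le => e e0.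
have eM : 0 < e / M by rewrite divr_gt0.
have [r r0 H] := @C1_strictly_differentiable (x t0) t0 (tau t0) _ t00 eM.
have bnd m (u : R -> 'rV[R]_m) (u' : 'rV[R]_m) : u s @[s --> F] --> u' ->
    \sum_i `|u' 0 i| + 1 <= M -> \forall s \near F, forall i, `|u s 0 i| <= M.
  move=> /cvg_ballP/(_ 1 ltr01) uu' uM; apply: filterS uu' => s [_ uu'] i.
  have := uu' 0 i; rewrite /ball /= => h.
  apply: (@le_trans _ _ (`|u' 0 i| + 1)).
    rewrite -[u s 0 i](subrK (u' 0 i)) addrC (le_trans (ler_normD _ _))//.
    by rewrite lerD2l distrC ltW.
  by apply: le_trans uM; rewrite lerD2r (bigD1 i)//= lerDl sumr_ge0.
near=> s; rewrite sub0r normrN.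
have st : s - t0 != 0.
  by rewrite subr_eq0; near: s; apply: Ft; exact: (@nbhs_dnbhs_neq _ t0).
have st0 : 0 < `|s - t0| by rewrite normr_gt0.
have -> : (s - t0)^-1 *: (V (x s) s (tau s) - V (x t0) t0 (tau t0)) - L s =
   (s - t0)^-1 * (V (x s) s (tau s) - V (x t0) t0 (tau t0) -
     D (x t0) t0 (tau t0) (x s - x t0) (s - t0) (tau s - tau t0)).
  rewrite /L !dotZr [RHS]mulrBr; congr (_ - _).
  by field.
rewrite normrM normfV mulrC ler_pdivrMr//.
have -> : e * `|s - t0| = e / M * (M * `|s - t0|) by rewrite mulrA divfK// gt_eqF.
have scal m (u : R -> 'rV[R]_m) i : `|((s - t0)^-1 *: (u s - u t0)) 0 i| <= M ->
    `|u s 0 i - u t0 0 i| <= M * `|s - t0|.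
  by rewrite !mxE normrM normfV mulrC ler_pdivrMr.
apply: H => //.
- split; first by near: s; exact: (cvg_ballP _ _).1 cx _ r0.
    by near: s; exact: (cvg_ballP _ _).1 Ft0 _ r0.
  by near: s; exact: (cvg_ballP _ _).1 ctau _ r0.
- by split; exact: ballxx.
- by near: s.
- move=> i; apply: scal; move: i; near: s; apply: bnd dx _.
  by rewrite lerD2r lerDl sumr_ge0.
- by rewrite ler_peMl.
- move=> i; apply: scal; move: i; near: s; apply: bnd dtau _.
  by rewrite lerD2r lerDr sumr_ge0.
Unshelve. all: by end_near. Qed.

End C1.
End strict_differentiability.

(** * Euclidean norm and gradients of compositions *)

Section vectors.
Context {R : realType}.

Lemma cvg_rV n (X : Type) (F : set_system X) {FF : Filter F}
    (u : X -> 'rV[R]_n) (l : 'rV[R]_n) :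
  (forall i, u s 0 i @[s --> F] --> l 0 i) -> u s @[s --> F] --> l.
Proof.
move=> ul; apply/cvg_ballP => e e0.
have H i : \forall s \near F, ball (l 0 i) e (u s 0 i).
  by apply: (cvg_ballP _ _).1 (ul i) _ e0.
have H' : \forall s \near F, forall i, ball (l 0 i) e (u s 0 i) by exact: filter_forall.
apply: filterS H' => s us; split => // i j.
by rewrite ord1; exact: us.
Qed.

Lemma enorm_ge0 n (v : 'rV[R]_n) : 0 <= enorm v.
Proof. exact: sqrtr_ge0. Qed.

Lemma enormZ n (v : 'rV[R]_n) (a : R) : 0 <= a -> enorm (a *: v) = a * enorm v.
Proof.
move=> a0; rewrite /enorm -[in RHS](ger0_norm a0) -sqrtr_sqr -sqrtrM ?sqr_ge0//.
by rewrite mulr_sumr; congr Num.sqrt; apply: eq_bigr => i _; rewrite mxE exprMn.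
Qed.

Lemma coord_le_enorm n (v : 'rV[R]_n) i : `|v 0 i| <= enorm v.
Proof.
rewrite -sqrtr_sqr ler_sqrt ?sumr_ge0// => [|j _]; last exact: sqr_ge0.
by rewrite (bigD1 i)//= lerDl sumr_ge0// => j _; exact: sqr_ge0.
Qed.

(** Coordinatewise bounds fit the hypothesis on [p], whose derivatives are bounded component by
    component. *)
Lemma dot_le_enorm n (G u : 'rV[R]_n) N : (forall i, `|u 0 i| <= N i) ->
  dot G u <= enorm G * \sum_i N i.
Proof.
move=> uN; rewrite mulr_sumr; apply: ler_sum => i _.
by rewrite (le_trans (ler_norm _))// normrM ler_pM// coord_le_enorm.
Qed.

Lemma is_derive_dirP n (g : 'rV[R]_n -> R) (x v : 'rV[R]_n) l :
  is_derive x v g l <-> is_derive (0 : R) 1 (fun h : R => g (h *: v + x)) l.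
Proof.
set G := fun h : R => g (h *: v + x).
have E : (fun h : R => h^-1 *: ((G \o shift 0) (h *: 1) - G 0)) =
    (fun h : R => h^-1 *: ((g \o shift x) (h *: v) - g x)).
  apply/funext => h; rewrite /G /= [h *: 1]mulr1.
  by rewrite addr0 scale0r add0r.
by split=> -[dg <-]; split; move: dg; rewrite /derivable /derive E.
Qed.

Lemma grad_comp n (g : 'rV[R]_n -> R) (k : R -> R) (x : 'rV[R]_n) k' :
  is_derive (g x) 1 k k' -> has_grad g x ->
  has_grad (k \o g) x /\ grad (k \o g) x = k' *: grad g x.
Proof.
move=> dk hg.
have dkg i : is_derive x (delta_mx 0 i) (k \o g) (k' * 'D_(delta_mx 0 i) g x).
  apply/is_derive_dirP.
  have dg : is_derive x (delta_mx 0 i) g ('D_(delta_mx 0 i) g x).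
    by split => //; exact: hg.
  apply: (@is_derive1_comp _ k (fun h : R => g (h *: delta_mx 0 i + x))).
    by rewrite scale0r add0r.
  exact/is_derive_dirP.
split=> [i|]; first by have [] := dkg i.
by apply/rowP => i; rewrite !mxE; have [_ ->] := dkg i.
Qed.

End vectors.

(** * Condition (E) for the rescaled function *)

Section composition_with_rescaling.
Context {R : realType} (n d : nat).

(** Continuity of the new gradients requires that of [k'] composed with V, hence the joint
    continuity of V. *)
Lemma C1_comp (V : 'rV[R]_n -> R -> 'rV[R]_d -> R) (k k' : R -> R) :
  C1_xttau V -> (forall v : R, is_derive v 1 k (k' v)) -> continuous k' ->
  let kV x t tau := k (V x t tau) in
  C1_xttau kV /\ forall x t tau, 0 <= t ->
    [/\ V_x kV x t tau = k' (V x t tau) *: V_x V x t tau,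
        V_t kV x t tau = k' (V x t tau) * V_t V x t tau
      & V_tau kV x t tau = k' (V x t tau) *: V_tau V x t tau].
Proof.
move=> VC1 dk ck' kV.
have cV := C1_continuous VC1.
have [dV cVx cVt cVtau] := VC1.
have dkVx x t tau : 0 <= t -> has_grad (fun y => kV y t tau) x /\
    V_x kV x t tau = k' (V x t tau) *: V_x V x t tau.
  by move=> t0; have [hg _ _] := dV x t tau t0; exact: (grad_comp (dk _) hg).
have dkVtau x t tau : 0 <= t -> has_grad (kV x t) tau /\
    V_tau kV x t tau = k' (V x t tau) *: V_tau V x t tau.
  by move=> t0; have [_ _ hg] := dV x t tau t0; exact: (grad_comp (dk _) hg).
have dkVt x t tau : 0 <= t -> derivable_from 0 (fun s => kV x s tau) t /\
    V_t kV x t tau = k' (V x t tau) * V_t V x t tau.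
  move=> t0; have [_ dVt _] := dV x t tau t0; apply: derive_fromE => //.
  have FF := dquot_filter t0.
  exact: (quot_cvg_comp (@dquot_cvg_id _ 0 t) (dk _) dVt).
have ck'V : {within [set z : 'rV[R]_n * R * 'rV[R]_d | 0 <= z.1.2],
    continuous (fun z => k' (V z.1.1 z.1.2 z.2))}.
  move=> z; apply: (@continuous_comp _ _ _ _ k'); first exact: cV.
  exact: ck'.
split; last by move=> x t tau t0; split; [exact: (dkVx _ _ _ _).2|
  exact: (dkVt _ _ _ _).2|exact: (dkVtau _ _ _ _).2].
split.
- move=> x t tau t0.
  by split; [exact: (dkVx _ _ _ _).1|exact: (dkVt _ _ _ _).1|exact: (dkVtau _ _ _ _).1].
- apply: (@subspace_eq_continuous _ _ _
    (fun z => k' (V z.1.1 z.1.2 z.2) *: V_x V z.1.1 z.1.2 z.2)).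
    by move=> z; rewrite inE /= => z0; rewrite /from_subspace (dkVx _ _ _ z0).2.
  by move=> z; apply: cvgZ; [exact: ck'V|exact: cVx].
- apply: (@subspace_eq_continuous _ _ _
    (fun z => k' (V z.1.1 z.1.2 z.2) * V_t V z.1.1 z.1.2 z.2)).
    by move=> z; rewrite inE /= => z0; rewrite /from_subspace (dkVt _ _ _ z0).2.
  by move=> z; apply: cvgM; [exact: ck'V|exact: cVt].
- apply: (@subspace_eq_continuous _ _ _
    (fun z => k' (V z.1.1 z.1.2 z.2) *: V_tau V z.1.1 z.1.2 z.2)).
    by move=> z; rewrite inE /= => z0; rewrite /from_subspace (dkVtau _ _ _ z0).2.
  by move=> z; apply: cvgZ; [exact: ck'V|exact: cVtau].
Qed.

Lemma bounded_derivatives_continuous (p : R -> 'rV[R]_d) :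
  bounded_derivatives p -> continuous p.
Proof.
move=> hp t; apply: cvg_rV => i.
by have [dp _] := hp i; apply: differentiable_continuous; apply/derivable1_diffP.
Qed.

Lemma condition_E_rescaled (f : 'rV[R]_n -> R -> 'rV[R]_d -> 'rV[R]_n)
    (p : R -> 'rV[R]_d) (V : 'rV[R]_n -> R -> 'rV[R]_d -> R)
    (q : 'rV[R]_d -> R) (alpha1 alpha2 mu k k' : R -> R) (T ca cb c : R) :
  continuous p -> continuous q -> 0 < T -> 0 < ca -> 0 < cb -> 0 < c ->
  class_Kinf alpha1 -> class_Kinf alpha2 -> class_Kinf k ->
  (forall v : R, is_derive v 1 k (k' v)) -> continuous k' ->
  (forall v, 0 <= v -> 0 <= k' v /\ k' v * mu v = c * k v) ->
  C1_xttau V -> (forall x t tau, 0 <= t -> 0 <= V x t tau) ->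
  (forall x t tau, 0 <= t -> range p tau ->
     [/\ alpha1 (enorm x) <= V x t tau <= alpha2 (enorm x),
         V_t V x t tau + dot (V_x V x t tau) (f x t tau)
           <= - q tau * mu (V x t tau)
       & enorm (V_tau V x t tau) <= ca * mu (V x t tau)]) ->
  (forall t, 0 <= t ->
     cb <= \int[lebesgue_measure]_(s in `[t - T, t]) q (p s)) ->
  condition_E_with f p (fun x t tau => k (V x t tau)) (fun tau => c * q tau) T.
Proof.
move=> cp cq T0 ca0 cb0 c0 Ka1 Ka2 Kk dk ck' k'mu VC1 V0 hV hint.
have [kVC1 kVE] := C1_comp VC1 dk ck'.
split => //.
- by split => // x t tau t0; apply: Kinf_ge0 => //; exact: V0.
- by move=> v; apply: (@cvgM _ _ (nbhs v) _ (fun=> c) q c (q v));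
    [exact: cvg_cst|exact: cq].
exists (k \o alpha1), (k \o alpha2), (c * ca), (c * cb); split.
- exact: Kinf_comp.
- exact: Kinf_comp.
- exact: mulr_gt0.
- exact: mulr_gt0.
move=> x t tau t0 ptau.
have [/andP[lo hi] dec Vtau] := hV x t tau t0 ptau.
have V0' := V0 x t tau t0; have [k'0 k'E] := k'mu _ V0'.
have [-> -> ->] := kVE x t tau t0.
have en0 := enorm_ge0 x.
split.
- rewrite /= !(Kinf_mono Kk) ?lo ?hi//; first exact: Kinf_ge0 Ka2 en0.
  exact: Kinf_ge0 Ka1 en0.
- rewrite dotZl -mulrDr (le_trans (ler_wpM2l k'0 dec))//.
  by rewrite mulrCA k'E !mulNr mulrCA mulrA.
- rewrite enormZ// (le_trans (ler_wpM2l k'0 Vtau))//.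
  by rewrite mulrCA k'E mulrCA mulrA.
- rewrite RintegralZl//; last first.
    apply: integrable_segment; apply: continuous_subspaceT => s.
    exact: (continuous_comp (cp s) (cq _)).
  by rewrite ler_pM2l// hint.
Qed.

End composition_with_rescaling.

(** * The double integral in the exponential weight *)

Section averaging_weight.
Context {R : realType}.
Local Notation mu := (@lebesgue_measure R).

(** With Q a primitive of [h] and P one of Q, the inner integral is Q r - Q s, so [J r] = T Q(r) -
    (P(r) - P(r - T)). This closed form avoids differentiating under an integral sign. *)
Lemma double_integral_weight (h : R -> R) (T M : R) : continuous h -> 0 < T ->
  (forall s, `|h s| <= M) ->
  let J r := \int[mu]_(s in `[r - T, r]) \int[mu]_(l in `[s, r]) h l in
  (forall r : R, is_derive r 1 J (T * h r - \int[mu]_(s in `[r - T, r]) h s)) /\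
  forall r, `|J r| <= M * T ^+ 2.
Proof.
move=> ch T0 hM J.
have [Q dQ] := primitive_exists ch.
have cQ := is_derive_continuous dQ.
have [P dP] := primitive_exists cQ.
have intQ a b : a <= b -> \int[mu]_(l in `[a, b]) h l = Q b - Q a.
  by move=> ab; apply: Rintegral_is_derive => //; exact: continuous_subspaceT.
have rT r : r - T <= r by rewrite gerBl ltW.
have JE : J = fun r => T * Q r - (P r - P (r - T)).
  apply/funext => r; rewrite /J.
  rewrite (@eq_Rintegral _ _ _ mu _ (fun s => Q r - Q s)); last first.
    move=> s; rewrite inE /= in_itv /= => /andP[_ sr]; exact: intQ.
  have dPQ (s : R) : is_derive s 1 (fun s : R => Q r * s - P s) (Q r - Q s).
    apply: (@is_deriveB _ _ _ (fun s : R => Q r * s) P).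
    by rewrite -[X in is_derive _ _ _ X]mulr1; apply: (@is_deriveZ _ _ _ id (Q r)).
  have cQ' : continuous (fun s => Q r - Q s).
    by move=> s; apply: cvgB; [exact: cvg_cst|exact: cQ].
  have H := @Rintegral_is_derive R _ _ _ _ (rT r) (fun s _ => dPQ s)
    (continuous_subspaceT cQ').
  by rewrite H; ring.
split=> [r|r].
  rewrite intQ// JE opprB addrC.
  have dPT : is_derive r 1 (fun r : R => P (r - T)) (Q (r - T)).
    rewrite -[Q _]mulr1; apply: (@is_derive1_comp _ P (fun r : R => r - T)).
    by rewrite -[X in is_derive _ _ _ X]subr0; apply: is_deriveB.
  have dTQ : is_derive r 1 (fun r : R => T * Q r) (T * h r).
    exact: (@is_deriveZ _ _ _ Q T).
  have -> : Q (r - T) - Q r + T * h r = T * h r - (Q r - Q (r - T)) by ring.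
  apply: (@is_deriveB _ _ _ (fun r => T * Q r) (fun r => P r - P (r - T))) => //.
rewrite JE.
have rTlt : r - T < r by rewrite gtrBl.
(* Two mean values, of P and then of Q, write [J r] as T (r - x) times a value of [h], with r - x <
   T. *)
have [|x xr ->] := @MVT R P Q (r - T) r rTlt.
  by apply: continuous_subspaceT; exact: is_derive_continuous dP.
move: xr; rewrite in_itv /= => /andP[rx xr].
have [|y yr E] := @MVT R Q h x r xr.
  exact: continuous_subspaceT.
have -> : T * Q r - Q x * (r - (r - T)) = (Q r - Q x) * T by ring.
rewrite E normrM normrM (ger0_norm (ltW T0)) expr2 mulrA ler_pM2r//.
rewrite ler_pM// gtr0_norm ?subr_gt0//; lra.
Qed.

Lemma window_integral_continuous (h : R -> R) (T : R) : continuous h -> 0 < T ->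
  continuous (fun r => \int[mu]_(s in `[r - T, r]) h s).
Proof.
move=> ch T0; have [Q dQ] := primitive_exists ch.
have cQ := is_derive_continuous dQ.
have -> : (fun r => \int[mu]_(s in `[r - T, r]) h s) = (fun r => Q r - Q (r - T)).
  apply/funext => r; apply: Rintegral_is_derive => //; first by rewrite gerBl ltW.
  exact: continuous_subspaceT.
move=> r; apply: cvgB; first exact: cQ.
apply: (@continuous_comp _ _ _ (fun r => r - T) Q); last exact: cQ.
by apply: cvgB; [exact: cvg_id|exact: cvg_cst].
Qed.

End averaging_weight.

(** * Dissipation, uniform stability and the Lyapunov function *)

Section Lyapunov_stability.
Context {R : realType} (n d : nat).
Variables (f : 'rV[R]_n -> R -> 'rV[R]_d -> 'rV[R]_n) (p : R -> 'rV[R]_d).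
Variables (V : 'rV[R]_n -> R -> 'rV[R]_d -> R) (q : 'rV[R]_d -> R) (T : R).
Hypotheses (hp : bounded_curve p) (hp' : bounded_derivatives p).
Hypothesis hE : condition_E_with f p V q T.

Let cp : continuous p := bounded_derivatives_continuous hp'.
Let cq : continuous q. Proof. by case: hE. Qed.
Let VC1 : C1_xttau V. Proof. by case: hE => -[]. Qed.
Let T0 : 0 < T. Proof. by case: hE. Qed.
Let cqp : continuous (q \o p).
Proof. by move=> s; apply: continuous_comp; [exact: cp|exact: cq]. Qed.

Let dp (t : R) : 'rV[R]_d := \row_i (fun s => p s 0 i)^`() t.

Let weight (alpha t : R) : R :=
  expR (alpha / T * \int[lebesgue_measure]_(s in `[t / alpha - T, t / alpha])
      \int[lebesgue_measure]_(l in `[s, t / alpha]) q (p l)).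

(** The factor alpha in the exponent cancels the 1/alpha that comes from differentiating t/alpha;
    dividing by [T] leaves the current rate minus its mean over the window. *)
Let weight' (alpha t : R) : R := weight alpha t * (q (p (t / alpha)) -
  (\int[lebesgue_measure]_(s in `[t / alpha - T, t / alpha]) q (p s)) / T).

Let W alpha := V_sharp p V q T alpha.

(* The derivative of W alpha along a curve with position x and velocity x' at
   time t. *)
Let W' alpha x t x' := weight' alpha t * V x t (p (t / alpha)) +
  weight alpha t * (dot (V_x V x t (p (t / alpha))) x' +
    V_t V x t (p (t / alpha)) * 1 +
    dot (V_tau V x t (p (t / alpha))) (alpha^-1 *: dp (t / alpha))).

(** The values of [p] lie in a compact cube, since each coordinate is bounded by the Euclidean
    norm. *)
Lemma q_bounded : exists M : R, forall s, `|q (p s)| <= M.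
Proof.
have [M pM] := hp.
pose A := [set v : 'rV[R]_d | forall i, `[- M, M] (v ord0 i)].
have cA : compact A.
  by apply: (@rV_compact R d (fun=> `[- M, M]%classic)) => i; exact: segment_compact.
have pA s : A (p s).
  move=> i; rewrite /= in_itv /= -ler_norml (le_trans _ (pM s))//.
  exact: coord_le_enorm.
have [|||c _ cmax] := @EVT_max_rV R d (fun v => `|q v|) A.
- by exists (p 0); exact: pA.
- exact: cA.
- apply: continuous_subspaceT => v.
  by apply: (@continuous_comp _ _ _ q); [exact: cq|exact: norm_continuous].
- by exists `|q c| => s; apply: cmax; rewrite inE; exact: pA.
Qed.

Lemma scale_is_derive (alpha t : R) :
  is_derive t 1 (fun s : R => s / alpha) alpha^-1.
Proof.
have -> : (fun s : R => s / alpha) = (fun s => alpha^-1 *: (s : R)).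
  by apply/funext => s; rewrite mulrC.
by rewrite -[X in is_derive _ _ _ X]mulr1; apply: (@is_deriveZ _ _ _ id alpha^-1).
Qed.

Lemma weight_is_derive alpha (t : R) : 0 < alpha ->
  is_derive t 1 (weight alpha) (weight' alpha t).
Proof.
move=> a0; have [M qM] := q_bounded.
have [dJ _] := double_integral_weight cqp T0 qM.
set J := (fun r => _) in dJ.
have dJa := @is_derive1_comp _ J (fun s : R => s / alpha) t _ _ (dJ _)
  (scale_is_derive alpha t).
have dX := @is_deriveZ _ _ _ _ (alpha / T) _ _ _ dJa.
have H := @is_derive1_comp _ expR _ t _ _ (is_derive_expR _) dX.
suff -> : weight' alpha t = weight alpha t * ((alpha / T) *
  ((T * q (p (t / alpha)) - \int[lebesgue_measure]_(s in `[t / alpha - T, t / alpha])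
     q (p s)) / alpha)) by exact: H.
rewrite /weight'; congr (_ * _).
by field; rewrite !gt_eqF.
Qed.

(** The bound, exp(alpha M T), is uniform in time but grows with alpha; alpha is fixed wherever it
    is used. *)
Lemma weight_bounds alpha : 0 < alpha -> exists2 B, 0 < B &
  forall t, B^-1 <= weight alpha t <= B.
Proof.
move=> a0; have [M qM] := q_bounded.
have [_ bJ] := double_integral_weight cqp T0 qM.
exists (expR (alpha / T * (M * T ^+ 2))); first exact: expR_gt0.
move=> t; rewrite -expRN !ler_expR -ler_norml normrM gtr0_norm ?divr_gt0//.
by rewrite ler_pM2l ?divr_gt0//; exact: bJ.
Qed.

Lemma p_quotient (F : set_system R) {FF : ProperFilter F} alpha (t : R) :
  F --> t^' ->
  (s - t)^-1 *: (p (s / alpha) - p (t / alpha)) @[s --> F]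
    --> alpha^-1 *: dp (t / alpha).
Proof.
move=> Ft; apply: cvg_rV => i.
have [dpi _] := hp' i.
have H : is_derive t 1 (fun s : R => p (s / alpha) 0 i)
   (derive1 (fun s => p s 0 i) (t / alpha) * alpha^-1).
  apply: (@is_derive1_comp _ (fun s => p s 0 i) (fun s : R => s / alpha)).
    by rewrite derive1E; exact: derivableP.
  exact: scale_is_derive.
move/is_derive_quotP in H.
have -> : (alpha^-1 *: dp (t / alpha)) 0 i =
    derive1 (fun s => p s 0 i) (t / alpha) * alpha^-1 by rewrite !mxE mulrC.
have -> : (fun s => ((s - t)^-1 *: (p (s / alpha) - p (t / alpha))) 0 i) =
    (fun s => (s - t)^-1 *: (p (s / alpha) 0 i - p (t / alpha) 0 i)).
  by apply/funext => s; rewrite !mxE.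
by apply: cvg_trans H; exact: cvg_app.
Qed.

(** One formula for two uses: along a trajectory it gives the decay, and along a constant curve the
    partial derivative in time. *)
Lemma W_quotient (F : set_system R) {FF : ProperFilter F} alpha (t : R)
    (x : R -> 'rV[R]_n) x' :
  0 < alpha -> 0 <= t -> F --> t^' -> (\forall s \near F, 0 <= s) ->
  (s - t)^-1 *: (x s - x t) @[s --> F] --> x' ->
  (s - t)^-1 *: (W alpha (x s) s - W alpha (x t) t) @[s --> F] -->
    W' alpha (x t) t x'.
Proof.
move=> a0 t0 Ft F0 dx.
have Ft0 : F --> t by apply: cvg_trans Ft (@nbhs_dnbhs _ t).
apply: (quot_cvgM Ft0).
  have /is_derive_quotP := weight_is_derive t a0.
  by apply: cvg_trans; exact: cvg_app.
by apply: (chain_rule VC1) => //; exact: p_quotient.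
Qed.

Lemma W_dissipation : exists2 alpha0, 0 < alpha0 & exists2 c, 0 < c &
  forall alpha x t, alpha0 <= alpha -> 0 <= t ->
    W' alpha x t (slow_system f p alpha x t) <= - c * W alpha x t.
Proof.
have [[_ V0] _ _ [alpha1 [alpha2 [ca [cb [Ka1 Ka2 ca0 cb0 hV]]]]]] := hE.
have /choice[M dpM] : forall i, exists M : R,
    forall t, `|(fun s => p s 0 i)^`() t| <= M.
  by move=> i; have [_] := hp' i.
pose P := \sum_i M i.
have P0 : 0 <= P by apply: sumr_ge0 => i _; exact: le_trans (dpM i 0).
have num0 : 0 <= 2 * T * ca * P / cb.
  by rewrite divr_ge0 ?(ltW cb0)// !mulr_ge0 ?(ltW ca0) ?(ltW T0).
(* Beyond this threshold the parameter drift, at most ca P v / alpha, consumes at most half of the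
   averaged decay cb v / T; the other half is the rate chosen next. The added 1 keeps the threshold
   positive when [P] is 0. *)
exists (2 * T * ca * P / cb + 1); first by rewrite ltr_wpDl.
exists (cb / (2 * T)); first by rewrite divr_gt0 ?mulr_gt0.
move=> alpha x t a0a t0.
have a0 : 0 < alpha.
  by apply: lt_le_trans a0a; rewrite ltr_wpDl.
have [|_ dec Vtau hint] := hV x (t) (p (t / alpha)) t0; first by exists (t / alpha).
(* The integral clause involves neither x nor tau, so it can be read at the rescaled time t/alpha
   with any point of the range, here [p 0]. *)
have {}hint : cb <= \int[lebesgue_measure]_(s in `[t / alpha - T, t / alpha]) q (p s).
  have ta0 : 0 <= t / alpha by rewrite divr_ge0// ltW.
  by have [|_ _ _] := hV x (t / alpha) (p 0) ta0; first by exists 0.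
have V0' := V0 x t (p (t / alpha)) t0.
rewrite /W' /W /V_sharp -/(weight alpha t) /weight' -mulrA -mulrDr mulrCA.
rewrite ler_pM2l ?expR_gt0//.
set I := \int[_]_(_ in _) _ in hint *.
set v := V x t _ in dec Vtau V0' *.
have dotP : dot (V_tau V x t (p (t / alpha))) (alpha^-1 *: dp (t / alpha)) <=
    cb / (2 * T) * v.
  rewrite dotZr.
  have := @dot_le_enorm _ _ (V_tau V x t (p (t / alpha))) (dp (t / alpha)) M.
  move=> /(_ _)/le_trans h.
  have h1 : dot (V_tau V x t (p (t / alpha))) (dp (t / alpha)) <= ca * v * P.
    by apply: h => [i|]; [rewrite mxE|rewrite ler_wpM2r].
  rewrite mulrC ler_pdivrMr// (le_trans h1)//.
  have : 2 * T * ca * P / cb <= alpha by apply: le_trans a0a; rewrite lerDl.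
  rewrite ler_pdivrMr// => h2.
  have -> : cb / (2 * T) * v * alpha = v / (2 * T) * (alpha * cb) by ring.
  have -> : ca * v * P = v / (2 * T) * (2 * T * ca * P).
    by field; rewrite gt_eqF.
  by rewrite ler_wpM2l// divr_ge0// mulr_ge0 ?ltW.
have IT : cb / T * v <= I / T * v.
  by rewrite ler_wpM2r// ler_pM2r ?invr_gt0.
have cbE : cb / (2 * T) * v = cb / T * v / 2 by field; rewrite gt_eqF.
move: dec dotP IT; rewrite cbE mulr1 /slow_system mulrBl mulNr mulNr cbE.
set A := cb / T * v; lra.
Qed.

Lemma W_sandwich alpha : 0 < alpha -> exists alpha1 alpha2 B,
  [/\ class_Kinf alpha1, class_Kinf alpha2, 0 < B &
    forall x t, 0 <= t -> [/\ 0 <= W alpha x t,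
      B^-1 * alpha1 (enorm x) <= W alpha x t & W alpha x t <= B * alpha2 (enorm x)]].
Proof.
have [[_ V0] _ _ [alpha1 [alpha2 [ca [cb [Ka1 Ka2 ca0 cb0 hV]]]]]] := hE.
move=> a0; have [B B0 EB] := weight_bounds a0.
exists alpha1, alpha2, B; split => // x t t0.
have [|/andP[lo hi] _ _ _] := hV x t (p (t / alpha)) t0; first by exists (t / alpha).
have V0' := V0 x t (p (t / alpha)) t0.
have /andP[E1 E2] := EB t.
rewrite /W /V_sharp -/(weight alpha t); split.
- by rewrite mulr_ge0// expR_ge0.
- by rewrite ler_pM// ?invr_ge0 ?(ltW B0)// (Kinf_ge0 Ka1)// enorm_ge0.
- by rewrite ler_pM// expR_ge0.
Qed.

(* W(phi(s), s) exp(c s) is nonincreasing along trajectories. *)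
Lemma UGAS_of_dissipation alpha c : 0 < alpha -> 0 < c ->
  (forall x t, 0 <= t ->
    W' alpha x t (slow_system f p alpha x t) <= - c * W alpha x t) ->
  UGAS (slow_system f p alpha).
Proof.
move=> a0 c0 diss.
have [alpha1 [alpha2 [B [Ka1 Ka2 B0 hW]]]] := W_sandwich a0.
have [kappa Kk kK] := Kinf_inverse Ka1.
(* One factor [B] comes from the lower bound of W at time t, the other from its upper bound at [t0];
   [kappa] then inverts [alpha1]. *)
exists (fun s t => kappa (B * B * alpha2 (Num.max 0 s) * expR (- (c * t)))).
  by apply: (@KL_of_exponential_decay R kappa alpha2 (B * B) c) => //; exact: mulr_gt0.
move=> x0 t0 phi t00 [phi0 dphi] t t0t.
have t_ge0 := le_trans t00 t0t.
pose w s := W alpha (phi s) s.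
have dw s : t0 <= s ->
    dquot t0 w s --> W' alpha (phi s) s (slow_system f p alpha (phi s) s).
  move=> t0s; have FF := dquot_filter t0s.
  apply: W_quotient => //; [exact: le_trans t0s|exact: cvg_within| |exact: dphi].
  apply: filterS (withinT _ _) => u; rewrite /= in_itv /= andbT.
  exact: le_trans.
pose e s := expR (c * s).
have de (s : R) : is_derive s 1 e (e s * c).
  apply: (@is_derive1_comp _ expR ( *%R c)).
  by rewrite -[X in is_derive _ _ _ X]mulr1; apply: (@is_deriveZ _ _ _ id c).
have wdecay : - (w t0 * e t0) <= - (w t * e t).
  apply: (@is_derive_ndecr R (fun s => - (w s * e s)) (fun s =>
    - (W' alpha (phi s) s (slow_system f p alpha (phi s) s) * e s +
       w s * (e s * c))) t0 t) => //.
    move=> s /andP[t0s st]; split.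
      apply: (@is_deriveN _ _ _ (fun s => w s * e s)).
      have dws := dquot_is_derive t0s (dw s (ltW t0s)).
      apply/is_derive_quotP; apply: quot_cvgM; first exact: nbhs_dnbhs.
        exact/is_derive_quotP.
      exact/is_derive_quotP.
    have s0 : 0 <= s by rewrite (le_trans t00)// ltW.
    have := diss (phi s) s s0; rewrite -/(w s) => h.
    rewrite oppr_ge0 mulrCA mulrC -mulrDr pmulr_rle0 ?expR_gt0//.
    by rewrite -lerBrDr sub0r [w s * c]mulrC -mulNr.
  (* At [t0] the trajectory has only a right derivative, which still gives continuity within the
     segment. *)
  apply/subspace_continuousP => s /=; rewrite in_itv /= => /andP[t0s _].
  apply: cvgN; apply: cvgM; last first.
    by apply: cvg_within_filter; exact: is_derive_continuous de s.
  apply: cvg_trans (dquot_continuous t0s (dw s t0s)); apply: cvg_app.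
  by apply: within_subset => u /=; rewrite !in_itv /= andbT => /andP[].
have [Wt0 _ Wt0_hi] := hW (phi t0) t0 t00.
have [_ Wt_lo _] := hW (phi t) t t_ge0.
rewrite lerN2 -/(w t) in wdecay Wt_lo.
set y := B * B * _ * _.
have max0 : Num.max 0 (enorm x0) = enorm x0 by rewrite max_r// enorm_ge0.
have y0 : 0 <= y.
  by rewrite /y !mulr_ge0 ?expR_ge0 ?(ltW B0)// (Kinf_ge0 Ka2)// max0 enorm_ge0.
have kappa_y0 := Kinf_ge0 Kk y0.
rewrite -(Kinf_mono Ka1) ?enorm_ge0// kK// /y max0.
have -> : expR (- (c * (t - t0))) = e t0 / e t.
  by rewrite /e -expRN -expRD; congr expR; ring.
rewrite mulrA ler_pdivlMr ?expR_gt0//.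
have h1 : alpha1 (enorm (phi t)) <= B * w t.
  by rewrite -ler_pdivrMl.
apply: (@le_trans _ _ (B * (w t * e t))).
  by rewrite mulrA ler_pM2r// expR_gt0.
have -> : B * B * alpha2 (enorm x0) * e t0 = B * (B * alpha2 (enorm x0) * e t0).
  by ring.
rewrite ler_pM2l// (le_trans wdecay)// ler_pM2r ?expR_gt0//.
by rewrite -phi0.
Qed.

(** The map (x, t) to (x, t, p(t/alpha)) preserves time, hence the domain t >= 0 on which [G] is
    continuous. *)
Lemma slow_within (S : topologicalType) (G : 'rV[R]_n * R * 'rV[R]_d -> S) alpha :
  {within [set z : 'rV[R]_n * R * 'rV[R]_d | 0 <= z.1.2], continuous G} ->
  {within [set z : 'rV[R]_n * R | 0 <= z.2],
    continuous (fun z => G (z.1, z.2, p (z.2 / alpha)))}.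
Proof.
move=> /subspace_continuousP cG; apply/subspace_continuousP => z z0.
apply: (cvg_comp (fun z : 'rV[R]_n * R => (z.1, z.2, p (z.2 / alpha))) G);
  last exact: (cG (z.1, z.2, p (z.2 / alpha)) z0).
apply: cvg_to_within; last exact: withinT.
apply: cvg_within_filter.
apply: (@cvg_pair _ _ _ (nbhs z) (nbhs (z.1, z.2)) (nbhs (p (z.2 / alpha))) _ _ _
  (fun z => (z.1, z.2)) (fun z => p (z.2 / alpha))).
  by apply: (@cvg_pair _ _ _ (nbhs z) (nbhs z.1) (nbhs z.2) _ _ _ fst snd);
    [exact: cvg_fst|exact: cvg_snd].
apply: (@continuous_comp _ _ _ (fun z : 'rV[R]_n * R => z.2 / alpha) p).
  by apply: cvgM; [exact: cvg_snd|exact: cvg_cst].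
exact: cp.
Qed.

Lemma time_within (S : topologicalType) (G : R -> S) : continuous G ->
  {within [set z : 'rV[R]_n * R | 0 <= z.2], continuous (fun z => G z.2)}.
Proof.
move=> cG; apply: continuous_subspaceT => z.
by apply: continuous_comp; [exact: cvg_snd|exact: cG].
Qed.

Lemma W_gradient alpha x t : 0 <= t ->
  has_grad (W alpha ^~ t) x /\
  W_x (W alpha) x t = weight alpha t *: V_x V x t (p (t / alpha)).
Proof.
move=> t0; have [dV _ _ _] := VC1; have [hg _ _] := dV x t (p (t / alpha)) t0.
apply: (@grad_comp _ _ (fun y => V y t (p (t / alpha))) ( *%R (weight alpha t)) x _ _ hg).
by rewrite -[X in is_derive _ _ _ X]mulr1; apply: (@is_deriveZ _ _ _ id (weight alpha t)).
Qed.

Lemma W_time_derivative alpha x t : 0 < alpha -> 0 <= t ->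
  derivable_from 0 (W alpha x) t /\ W_t (W alpha) x t = W' alpha x t 0.
Proof.
move=> a0 t0; have FF := dquot_filter t0; apply: derive_fromE => //.
apply: (@W_quotient _ FF alpha t (fun=> x)) => //; first exact: cvg_within.
  by apply: filterS (withinT _ _) => u; rewrite /= in_itv /= andbT.
under eq_cvg do rewrite subrr scaler0.
exact: cvg_cst.
Qed.

Lemma W_C1 alpha : 0 < alpha -> continuous_derivatives p -> C1_xt (W alpha).
Proof.
move=> a0 cp'; have [_ cVx cVt cVtau] := VC1.
have cV := C1_continuous VC1.
have cw : continuous (weight alpha).
  exact: is_derive_continuous (fun t => weight_is_derive t a0).
have cscale : continuous (fun t : R => t / alpha).
  by move=> t; apply: cvgM; [exact: cvg_id|exact: cvg_cst].
have cw' : continuous (weight' alpha).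
  move=> t; apply: cvgM; first exact: cw.
  apply: cvgB.
    by apply: (@continuous_comp _ _ _ (fun t : R => t / alpha) (q \o p));
      [exact: cscale|exact: cqp].
  apply: cvgM; last exact: cvg_cst.
  apply: (@continuous_comp _ _ _ (fun t : R => t / alpha)
    (fun r => \int[lebesgue_measure]_(s in `[r - T, r]) q (p s))); first exact: cscale.
  exact: (window_integral_continuous cqp T0).
have cdp : continuous (fun t : R => alpha^-1 *: dp (t / alpha)).
  move=> t; apply: cvgZ; first exact: cvg_cst.
  apply: (@continuous_comp _ _ _ (fun t : R => t / alpha) dp); first exact: cscale.
  apply: cvg_rV => i; rewrite mxE.
  have -> : (fun s => dp s 0 i) = derive1 (fun s => p s 0 i).
    by apply/funext => s; rewrite mxE.
  exact: cp'.
split.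
- move=> x t t0; split; first exact: (W_gradient _ _ t0).1.
  exact: (W_time_derivative _ a0 t0).1.
- apply: (@subspace_eq_continuous _ _ _
    (fun z => weight alpha z.2 *: V_x V z.1 z.2 (p (z.2 / alpha)))).
    by move=> z; rewrite inE /= => z0; rewrite /from_subspace (W_gradient _ _ z0).2.
  move=> z; apply: cvgZ; first exact: (time_within cw).
  exact: (slow_within cVx).
- apply: (@subspace_eq_continuous _ _ _ (fun z => W' alpha z.1 z.2 0)).
    move=> z; rewrite inE /= => z0.
    by rewrite /from_subspace (W_time_derivative _ a0 z0).2.
  move=> z; apply: cvgD.
    by apply: cvgM; [exact: (time_within cw')|exact: (slow_within cV)].
  apply: cvgM; first exact: (time_within cw).
  apply: cvgD; last first.
    by apply: cvg_dot; [exact: (slow_within cVtau)|exact: (time_within cdp)].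
  apply: cvgD.
    by apply: cvg_dot; [exact: (slow_within cVx)|exact: cvg_cst].
  by apply: cvgM; [exact: (slow_within cVt)|exact: cvg_cst].
Qed.

Lemma lyapunov_of_dissipation alpha c : 0 < alpha -> 0 < c ->
  continuous_derivatives p ->
  (forall x t, 0 <= t ->
    W' alpha x t (slow_system f p alpha x t) <= - c * W alpha x t) ->
  lyapunov_function (slow_system f p alpha) (W alpha).
Proof.
move=> a0 c0 cp' diss.
have [alpha1 [alpha2 [B [Ka1 Ka2 B0 hW]]]] := W_sandwich a0.
have B0' : 0 < B^-1 by rewrite invr_gt0.
split; first exact: W_C1.
  by move=> x t t0; have [] := hW x t t0.
have Ka1' := Kinf_comp (Kinf_scale B0') Ka1.
(* The third function is [c] times the lower bound of W, so that -c W is at most its opposite. *)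
exists ( *%R B^-1 \o alpha1), ( *%R B \o alpha2), ( *%R c \o ( *%R B^-1 \o alpha1)).
split => //.
- exact: Kinf_comp (Kinf_scale B0) Ka2.
- by apply: Kinf_positive_definite; exact: Kinf_comp (Kinf_scale c0) Ka1'.
move=> x t t0; have [_ lo hi] := hW x t t0; split => //.
rewrite (W_gradient _ _ t0).2 (W_time_derivative _ a0 t0).2 dotZl.
(* [W'] is affine in the velocity: its value at 0 is the partial derivative in time, and its linear
   part is the spatial gradient paired with the velocity. *)
have -> : W' alpha x t 0 + weight alpha t * dot (V_x V x t (p (t / alpha)))
    (slow_system f p alpha x t) = W' alpha x t (slow_system f p alpha x t).
  by rewrite /W' dot0; ring.
apply: (le_trans (diss x t t0)); rewrite mulNr lerN2 /=.
by rewrite ler_pM2l.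
Qed.

Lemma slow_system_stability : exists2 alpha0 : R, 0 < alpha0 &
  forall alpha, alpha0 <= alpha ->
    UGAS (slow_system f p alpha) /\
    (continuous_derivatives p ->
     lyapunov_function (slow_system f p alpha) (V_sharp p V q T alpha)).
Proof.
have [alpha0 alpha00 [c c0 diss]] := W_dissipation.
exists alpha0 => // alpha alpha0a; have a0 := lt_le_trans alpha00 alpha0a.
split=> [|cp']; first by apply: (UGAS_of_dissipation a0 c0) => x t; exact: diss.
by apply: (lyapunov_of_dissipation a0 c0 cp') => x t; exact: diss.
Qed.

End Lyapunov_stability.

Theorem theorem10 (R : realType) (n d : nat)
    (f : 'rV[R]_n -> R -> 'rV[R]_d -> 'rV[R]_n) (p : R -> 'rV[R]_d)
    (hp : bounded_curve p) (hp' : bounded_derivatives p)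
    (hstanding : standing_assumptions f p)
    (alpha1 alpha2 mu : R -> R) (T ca cb : R) (q : 'rV[R]_d -> R)
    (V : 'rV[R]_n -> R -> 'rV[R]_d -> R)
    (halpha1 : class_Kinf alpha1) (halpha2 : class_Kinf alpha2)
    (hmu : positive_definite mu) (hmu1 : C1_halfline mu)
    (hT : 0 < T) (hca : 0 < ca) (hcb : 0 < cb)
    (hq : continuous q)
    (hV1 : C1_xttau V) (hV0 : forall x t tau, 0 <= t -> 0 <= V x t tau)
    (hdiv : (\int[lebesgue_measure]_(l in `[1, r]) (mu l)^-1)
              @[r --> +oo] --> +oo)
    (hbounds : forall x t tau, 0 <= t -> range p tau ->
       alpha1 (enorm x) <= V x t tau <= alpha2 (enorm x))
    (hdecay : forall x t tau, 0 <= t -> range p tau ->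
       V_t V x t tau + dot (V_x V x t tau) (f x t tau)
         <= - q tau * mu (V x t tau))
    (hVtau : forall x t tau, 0 <= t -> range p tau ->
       enorm (V_tau V x t tau) <= ca * mu (V x t tau))
    (hint : forall t, 0 <= t ->
       cb <= \int[lebesgue_measure]_(s in `[t - T, t]) q (p s)) :
  exists k : R -> R,
    [/\ class_Kinf k,
        condition_E f p (fun x t tau => k (V x t tau))
      & forall (qE : 'rV[R]_d -> R) (TE : R),
          condition_E_with f p (fun x t tau => k (V x t tau)) qE TE ->
          exists2 alpha0 : R, 0 < alpha0 & forall alpha, alpha0 <= alpha ->
            UGAS (slow_system f p alpha) /\
            (continuous_derivatives p ->
             lyapunov_function (slow_system f p alpha)
               (V_sharp p (fun x t tau => k (V x t tau)) qE TE alpha))].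
Proof.
have [k [k' [c [Kk c0 ck' dk k'mu]]]] := rescaling_exists hmu hmu1 hdiv.
have cp := bounded_derivatives_continuous hp'.
exists k; split => //.
  exists (fun tau => c * q tau), T.
  apply: (condition_E_rescaled cp hq hT hca hcb c0 halpha1 halpha2 Kk dk ck' k'mu) => //.
  by move=> x t tau t0 ptau; split; [exact: hbounds|exact: hdecay|exact: hVtau].
(* The stability argument starts from Condition (E) alone, so it covers every admissible pair [qE],
   [TE] and not just the one constructed above. *)
by move=> qE TE hE; exact: (slow_system_stability hp hp' hE).
Qed.
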